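(* Let $K\in\mathcal T_H$, let $v\in H^1(\mathcal T_H)$ be such that $\operatorname{supp}v\subset K$, and let $\tilde\mu_h^\triangle=P^\triangle v$. Then, for any integer $j\ge1$, $$|T\tilde\mu_h^\triangle|_{H_{\mathcal A}^1(\mathcal T_H\setminus\mathcal T_{j+1}(K))}^2\le e^{-\frac{[(j+1)/2]}{1+N^f\alpha_{\rm stab}}}\,|T\tilde\mu_h^\triangle|_{H_{\mathcal A}^1(\mathcal T_H)}^2,$$ where $[s]$ is the integer part of $s$ and $N^f$ is the maximum number of faces that an element of $\mathcal T_H$ might have.
   Context: Setting. Let $d\in\{2,3\}$, let $\Omega\subset\mathbb R^d$ be an open bounded domain with polyhedral boundary, and let $\mathcal A\in[L^\infty(\Omega)]^{d\times d}$ be a symmetric tensor such that for almost all $x\in\Omega$, $a_{\min}|w|^2\le a_-(x)|w|^2\le\mathcal A(x)w\cdot w\le a_+(x)|w|^2\le a_{\max}|w|^2$ for all $w\in\mathbb R^d$, where $a_{\min},a_{\max}$ are positive constants and $a_-(x),a_+(x)$ are the smallest and largest eigenvalues of $\mathcal A(x)$. $\mathcal T_H$ is a (shape) regular polyhedral mesh of $\Omega$ whose elements have diameter smaller than $H$ and at most $N^f$ faces (''face'' means edge if $d=2$); $\mathcal F_H$ is its set of faces. $\mathcal F_h$ is a partition of these faces, of characteristic mesh size $h$, such that every face in $\mathcal F_H$ is a union of faces of $\mathcal F_h$. $n^\tau$ is the outward unit normal on $\partial\tau$. Spaces. $H^1(\mathcal T_H)=\{v\in L^2(\Omega): v|_\tau\in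 H^1(\tau),\ \tau\in\mathcal T_H\}$; $\Lambda(\mathcal T_H)=\{\prod_{\tau\in\mathcal T_H}\boldsymbol\tau\cdot n^\tau|_{\partial\tau}:\boldsymbol\tau\in H(\mathrm{div};\Omega)\}$ (so on an interior face an element takes opposite values on the two sides). $(\mu,v)_{\partial\tau}$ is the $H^{-1/2}(\partial\tau)$–$H^{1/2}(\partial\tau)$ duality (with the trace of $v$), and $(\mu,v)_{\partial\mathcal T_H}=\sum_{\tau\in\mathcal T_H}(\mu,v)_{\partial\tau}$. $\Lambda_h$ is the set of elements of $\Lambda(\mathcal T_H)$ that are constant on each face of $\mathcal F_h$. $\mathbb P^0(\mathcal T_H)$ is the space of functions constant on each $\tau\in\mathcal T_H$; $\widetilde H^1(\mathcal T_H)$ is the set of $v\in H^1(\mathcal T_H)$ with $\int_\tau v=0$ for all $\tau$. $\widetilde\Lambda_h=\{\mu_h\in\Lambda_h:(\mu_h,v^0)_{\partial\mathcal T_H}=0\ \forall v^0\in\mathbb P^0(\mathcal T_H)\}$, and $\widetilde\Lambda_h^f=\{\mu_h\in\widetilde\Lambda_h:\int_F\mu_h\,ds=0$ for each face $F\subset\partial\tau$, $\tau\in\mathcal T_H\}$. For $S\subset\mathcal T_H$, $|v|^2_{H^1_{\mathcal A}(S)}=\sum_{\tau\in S}\|\mathcal A^{1/2}\nabla v\|^2_{L^2(\tau)}$ (and one writes $\tau$ for $\{\tau\}$). Operator $T$. $T:\Lambda(\mathcal T_H)\to\widetilde H^1(\mathcal T_H)$ is defined elementwise by $\int_\tau\mathcal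 A\nabla(T\mu)\cdot\nabla\tilde v\,dx=(\mu,\tilde v)_{\partial\tau}$ for all $\tilde v\in\widetilde H^1(\mathcal T_H)$, $\tau\in\mathcal T_H$. On a single element $T$ acts likewise on data given on $\partial\tau$. Spectral spaces. For $\tau\in\mathcal T_H$ and a face $F$ of $\tau$ put $F_\tau^c=\partial\tau\setminus F$, and let $\widetilde\Lambda_h^\tau,\widetilde\Lambda_h^F,\widetilde\Lambda_h^{F_\tau^c}$ be the restrictions of $\widetilde\Lambda_h^f$ to $\partial\tau$, $F$, $F_\tau^c$; identify $\widetilde\Lambda_h^\tau=\widetilde\Lambda_h^F\times\widetilde\Lambda_h^{F_\tau^c}$, writing $\{\tilde\mu^F,\tilde\mu^{F_\tau^c}\}$ for its elements. Let $T_{FF}^\tau,T_{FF^c}^\tau,T_{F^cF}^\tau,T_{F^cF^c}^\tau$ be the blocks of the bilinear form $(\cdot,T\cdot)_{\partial\tau}$ on $\widetilde\Lambda_h^\tau$ for this splitting (e.g. $(\tilde\nu^F,T_{FF}^\tau\tilde\mu^F)_F=(\{\tilde\nu^F,0\},T\{\tilde\mu^F,0\})_{\partial\tau}$), and $\hat T_{FF}^\tau=T_{FF}^\tau-T_{FF^c}^\tau(T_{F^cF^c}^\tau)^{-1}T_{F^cF}^\tau$. Consider eigenpairs $(\alpha_i^F,\tilde\mu_{h,i}^F)\in\mathbb R\times\widetilde\Lambda_h^F$, $\alpha_1^F\le\alpha_2^F\le\dots$, of: if $F$ is shared by $\tau,\tau'$, $(\tilde\nu^F,(T_{FF}^\tau+T_{FF}^{\tau'})\tilde\mu_{h,i}^F)_F=\alpha_i^F(\tilde\nu^F,(\hat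 T_{FF}^\tau+\hat T_{FF}^{\tau'})\tilde\mu_{h,i}^F)_F$ for all $\tilde\nu^F\in\widetilde\Lambda_h^F$; if $F\subset\partial\Omega$, $(\tilde\nu^F,T_{FF}^\tau\tilde\mu_{h,i}^F)_F=\alpha_i^F(\tilde\nu^F,\hat T_{FF}^\tau\tilde\mu_{h,i}^F)_F$ for all $\tilde\nu^F$. The eigenfunctions are a basis of $\widetilde\Lambda_h^F$ orthonormal with respect to the right-hand-side form. Let $\alpha_{\rm stab}\ge1$ be a user-defined constant, $\widetilde\Lambda_h^{F,\triangle}=\mathrm{span}\{\tilde\mu_{h,i}^F:\alpha_i^F<\alpha_{\rm stab}\}$, $\widetilde\Lambda_h^{F,\Pi}=\mathrm{span}\{\tilde\mu_{h,i}^F:\alpha_i^F\ge\alpha_{\rm stab}\}$, $\widetilde\Lambda_h^\triangle=\{\tilde\mu_h\in\widetilde\Lambda_h^f:\tilde\mu_h|_F\in\widetilde\Lambda_h^{F,\triangle}\ \forall F\in\mathcal F_H\}$, and $\widetilde\Lambda_h^\Pi$ is defined in the same way with $\Pi$ in place of $\triangle$. Operator $P^\triangle$. $P^\triangle:H^1(\mathcal T_H)\to\widetilde\Lambda_h^\triangle$ is defined by $(\tilde\mu_h^\triangle,TP^\triangle w)_{\partial\mathcal T_H}=(\tilde\mu_h^\triangle,w)_{\partial\mathcal T_H}$ for all $\tilde\mu_h^\triangle\in\widetilde\Lambda_h^\triangle$. Patches. For $K\in\mathcal T_H$, $\mathcal T_0(K)=\emptyset$, $\mathcal T_1(K)=\{K\}$,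 and $\mathcal T_{j+1}(K)=\{\tau\in\mathcal T_H:\overline\tau\cap\overline{\tau_j}\ne\emptyset\text{ for some }\tau_j\in\mathcal T_j(K)\}$ for $j\ge1$. *)

(* Defs.v *)
From HB Require Import structures.
From mathcomp Require Import all_boot all_order all_algebra.
From mathcomp Require Import all_classical all_reals all_analysis.
Set Implicit Arguments.
Unset Strict Implicit.
Unset Printing Implicit Defensive.
Import Order.TTheory GRing.Theory Num.Theory.
Import numFieldNormedType.Exports.
Local Open Scope classical_set_scope.
Local Open Scope ring_scope.

Definition rV_display : measure_display.
Proof. exact: default_measure_display. Qed.

(* Borel sets of R^n: the sigma-algebra generated by the coordinates. *)
Section rV_measurable.
Context {R : realType} {n : nat}.

Definition rV_coord (i : 'I_n) (x : 'rV[R]_n) : measurableTypeR R := x ord0 i.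

Let rV_set0 : g_sigma_preimage rV_coord set0.
Proof. exact: sigma_algebra0. Qed.

Let rV_setC A : g_sigma_preimage rV_coord A -> g_sigma_preimage rV_coord (~` A).
Proof. exact: sigma_algebraC. Qed.

Let rV_bigcup (F : (set 'rV[R]_n)^nat) :
  (forall i, g_sigma_preimage rV_coord (F i)) ->
  g_sigma_preimage rV_coord (\bigcup_i (F i)).
Proof. exact: sigma_algebra_bigcup. Qed.

HB.instance Definition _ := @isMeasurable.Build rV_display
  'rV[R]_n (g_sigma_preimage rV_coord) rV_set0 rV_setC rV_bigcup.
End rV_measurable.

Section leb.
Context {R : realType}.

Lemma measurable_rV_coord n (i : 'I_n) :
  measurable_fun [set: 'rV[R]_n] (rV_coord i).
Proof.
move=> _ Y mY; rewrite setTI; apply: sub_sigma_algebra => /=.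
rewrite -bigcup_seq/=; exists i => /=; first by rewrite mem_index_enum.
by exists Y => //; rewrite setTI.
Qed.

Lemma measurable_fun_rV d (T : measurableType d) n (f : T -> 'rV[R]_n) :
  (forall i, measurable_fun [set: T] (rV_coord i \o f)) ->
  measurable_fun [set: T] f.
Proof.
move=> mf; suff: g_sigma_preimage (fun i => rV_coord i \o f) `<=` measurable.
  rewrite g_sigma_preimage_comp => prefS _ A mA.
  by apply: prefS; exists A.
apply: smallest_sub; first exact: sigma_algebra_measurable.
case: n => [|n] in f mf *; first by rewrite big_ord0.
rewrite -bigcup_mkord_ord; apply: bigcup_sub => i Ii.
by move=> A [B mB <-]; exact: mf.
Qed.

(* Lebesgue measure on R^n: the iterated product of the one on R, along the
   bijection rV_cons between R * R^n and R^(n+1). *)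
Definition rV_cons n (p : measurableTypeR R * 'rV[R]_n) : 'rV[R]_n.+1 :=
  row_mx (p.1)%:M p.2 : 'rV[R]_(1 + n).

Lemma measurable_rV_cons n : measurable_fun setT (@rV_cons n).
Proof.
apply: measurable_fun_rV => i.
have [j ->|j ->] := @split_ordP 1 n i.
  rewrite (_ : _ \o _ = fst); first exact: measurable_fst.
  by apply/funext => p; apply: etrans (row_mxEl _ _ _ _) _; rewrite mxE [j]ord1.
rewrite (_ : _ \o _ = rV_coord j \o snd).
  by apply: measurableT_comp => //; exact: measurable_rV_coord.
by apply/funext => p; exact: (row_mxEr (p.1)%:M p.2).
Qed.

Section step.
Variables (n : nat) (m : {sigma_finite_measure set 'rV[R]_n -> \bar R}).

Definition lebS : set 'rV[R]_n.+1 -> \bar R :=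
  pushforward (lebesgue_measure \x m)%E (@rV_cons n).

Let lebS0 : lebS set0 = 0%E.
Proof. by rewrite /lebS /pushforward preimage_set0 measure0. Qed.

Let lebS_ge0 A : (0 <= lebS A)%E.
Proof. by rewrite /lebS /pushforward; exact: measure_ge0. Qed.

Let lebS_sigma_additive : semi_sigma_additive lebS.
Proof.
move=> F mF tF mUF; rewrite /lebS /pushforward preimage_bigcup.
have mc B : measurable B -> measurable (@rV_cons n @^-1` B).
  by move=> mB; rewrite -[X in measurable X]setTI; exact: measurable_rV_cons.
apply: measure_semi_sigma_additive.
- by move=> k; exact: mc.
- apply/trivIsetP => /= i j _ _ ij; rewrite -preimage_setI.
  by move/trivIsetP : tF => /(_ _ _ _ _ ij) ->//; rewrite preimage_set0.
- by rewrite -preimage_bigcup; exact: mc.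
Qed.

HB.instance Definition _ := isMeasure.Build _ _ _ lebS
  lebS0 lebS_ge0 lebS_sigma_additive.

Let lebS_sigma_finite : sigma_finite setT lebS.
Proof.
pose c (x : 'rV[R]_n.+1) : measurableTypeR R * 'rV[R]_n :=
  ((x : 'rV[R]_(1 + n)) ord0 ord0, rsubmx (x : 'rV[R]_(1 + n))).
have cK p : c (rV_cons p) = p.
  case: p => a u; rewrite /c /rV_cons row_mxKr; congr pair.
  transitivity ((a%:M : 'M[R]_1) ord0 ord0); last by rewrite mxE.
  apply: etrans (row_mxEl (a%:M : 'M[R]_1) u ord0 ord0).
  by congr (fun_of_matrix _ _ _); exact/val_inj.
have mc : measurable_fun setT c.
  apply: measurable_fun_pair; first exact: (measurable_rV_coord (n := n.+1)).
  apply: measurable_fun_rV => i.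
  rewrite (_ : _ \o _ = rV_coord (rshift 1 i : 'I_n.+1)).
    exact: (measurable_rV_coord (n := n.+1)).
  by apply/funext => x; rewrite /rV_coord /= mxE.
have /sigma_finiteP[F [TF ndF Foo]] := sigma_finiteT (@lebesgue_measure R).
have /sigma_finiteP[G [TG ndG Goo]] := sigma_finiteT m.
exists (fun k => c @^-1` (F k `*` G k)).
  rewrite -preimage_bigcup (_ : \bigcup_k _ = setT) ?preimage_setT//.
  apply/esym; rewrite -setXTT TF TG predeqE => -[x y]; split.
    move=> [/= [k _ Fkx] [l _ Gly]]; exists (maxn k l) => //; split.
    - by move: x Fkx; exact/subsetPset/ndF/leq_maxl.
    - by move: y Gly; exact/subsetPset/ndG/leq_maxr.
  by move=> [k _ []/= ? ?]; split; exists k.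
move=> k; have [? ?] := Foo k; have [? ?] := Goo k; split.
  by rewrite -[X in measurable X]setTI; apply: mc => //; exact: measurableX.
rewrite /lebS /pushforward (_ : _ @^-1` _ = F k `*` G k).
  by rewrite product_measure1E// lte_mul_pinfty// ge0_fin_numE.
by rewrite -comp_preimage (_ : c \o _ = id)//; apply/funext => p; exact: cK.
Qed.

HB.instance Definition _ := Measure_isSigmaFinite.Build _ _ _ lebS
  lebS_sigma_finite.
End step.

Fixpoint leb_rec n : {sigma_finite_measure set 'rV[R]_n -> \bar R} :=
  if n is k.+1 then lebS (leb_rec k)
  else dirac (0 : 'rV[R]_0).

Definition leb n : set 'rV[R]_n -> \bar R := leb_rec n.
HB.instance Definition _ n := SigmaFiniteMeasure.on (@leb n).
End leb.
Arguments leb {R} n.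

Section euclid.
Context {R : realType} {n : nat}.
Implicit Types (x y : 'rV[R]_n) (D : set 'rV[R]_n).

(* The library norm on 'rV[R]_n is the max norm; lengths and diameters below
   are Euclidean. *)
Definition dot x y : R := \sum_i x ord0 i * y ord0 i.
Definition enorm x : R := Num.sqrt (dot x x).
Definition diam D : R := sup [set enorm (p.1 - p.2) | p in D `*` D].

Definition bdry D := closure D `\` D°.

Definition hyperplane (p : 'rV[R]_n * R) := [set x | dot p.1 x = p.2].

(* The condition (closure D)° = D excludes cracks and punctures. *)
Definition polyhedral_domain D :=
  [/\ D !=set0, open D, connected D & bounded_set D] /\
  ((closure D)° = D /\
   exists s : seq ('rV[R]_n * R),
     (forall p, p \in s -> p.1 != 0) /\
     bdry D `<=` \bigcup_(p in [set` s]) hyperplane p).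

(* Near each boundary point, D is the strict subgraph, in some direction e, of
   a Lipschitz function of the variables orthogonal to e. *)
Definition lipschitz_domain D :=
  forall x, bdry D x -> exists (e : 'rV[R]_n) (phi : 'rV[R]_n -> R) (r L : R),
    [/\ 0 < r, dot e e = 1,
        forall y t, phi (y + t *: e) = phi y,
        forall y z, `|phi y - phi z| <= L * enorm (y - z) &
        forall y, enorm (y - x) < r -> (D y <-> dot y e < phi y)].

Definition partial (i : 'I_n) (phi : 'rV[R]_n -> R) : 'rV[R]_n -> R :=
  fun x => 'D_(delta_mx ord0 i : 'rV[R]_n) phi x.

Definition grad (phi : 'rV[R]_n -> R) : 'rV[R]_n -> 'rV[R]_n :=
  fun x => \row_i partial i phi x.

Definition C1 (phi : 'rV[R]_n -> R) :=
  forall i, (forall x, derivable phi x (delta_mx ord0 i)) /\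
            continuous (partial i phi).

(* C^1 test functions yield the same weak derivatives as smooth ones. *)
Definition test_fun D (phi : 'rV[R]_n -> R) :=
  [/\ C1 phi, compact (closure [set x | phi x != 0]) &
      closure [set x | phi x != 0] `<=` D].

Definition L2 D (f : 'rV[R]_n -> R) :=
  measurable_fun D f /\ (leb n).-integrable D (fun x => (f x ^+ 2)%:E).

(* An element of H^1 is carried together with its weak gradient: it is a pair
   (v, G) with v, G in L^2 and G the distributional gradient of v (G is
   determined by v up to a null set). *)
Definition h1fun : Type := (('rV[R]_n -> R) * ('rV[R]_n -> 'rV[R]_n))%type.

Definition H1 D (w : h1fun) :=
  [/\ L2 D w.1,
      forall i, L2 D (fun x => w.2 x ord0 i) &
      forall phi, test_fun D phi -> forall i,
        \int[leb n]_(x in D) (w.1 x * partial i phi x) =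
        - \int[leb n]_(x in D) (w.2 x ord0 i * phi x)].

Definition H1sqnorm D (w : h1fun) : R :=
  \int[leb n]_(x in D) (w.1 x ^+ 2) +
  \int[leb n]_(x in D) dot (w.2 x) (w.2 x).

Definition H1mean0 D (w : h1fun) := H1 D w /\ \int[leb n]_(x in D) w.1 x = 0.

Definition h1_lin (a : R) (u v : h1fun) : h1fun :=
  (fun x => a * u.1 x + v.1 x, fun x => a *: u.2 x + v.2 x).

(* (s, q): a vector field together with its weak divergence. *)
Definition Hdiv D (s : 'rV[R]_n -> 'rV[R]_n) (q : 'rV[R]_n -> R) :=
  [/\ forall i, L2 D (fun x => s x ord0 i), L2 D q &
      forall phi, test_fun D phi ->
        \int[leb n]_(x in D) dot (s x) (grad phi x) =
        - \int[leb n]_(x in D) (q x * phi x)].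

(* Matrices act on row vectors from the right; A x is symmetric for almost
   every x, so w *m A x is the (transposed) product A(x)w.  Ah is A^{1/2}. *)
Definition elliptic_tensor (Omega : set 'rV[R]_n) (A Ah : 'rV[R]_n -> 'M[R]_n)
    (amin amax : R) (am ap : 'rV[R]_n -> R) :=
  [/\ 0 < amin /\ 0 < amax,
      forall i j, measurable_fun Omega (fun x => A x i j),
      forall i j, exists M, {ae leb n, forall x, Omega x -> `|A x i j| <= M},
      {ae leb n, forall x, Omega x ->
        [/\ (A x)^T = A x,
            eigenvalue (A x) (am x) /\
              (forall l, eigenvalue (A x) l -> am x <= l),
            eigenvalue (A x) (ap x) /\
              (forall l, eigenvalue (A x) l -> l <= ap x) &
            forall w : 'rV[R]_n,
              [/\ amin * dot w w <= am x * dot w w,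
                  am x * dot w w <= dot (w *m A x) w,
                  dot (w *m A x) w <= ap x * dot w w &
                  ap x * dot w w <= amax * dot w w]]} &
      (forall i j, measurable_fun Omega (fun x => Ah x i j)) /\
      {ae leb n, forall x, Omega x ->
        [/\ (Ah x)^T = Ah x, forall w : 'rV[R]_n, 0 <= dot (w *m Ah x) w &
            Ah x *m Ah x = A x]}].

End euclid.
Arguments h1fun : clear implicits.

(* The faces are parametrized: face F lies in the image of the isometry
   z |-> forg F + z *m ffrm F from R^(d-1), and fdom F, sdom e are the
   parameter domains of the faces F and of the subfaces e, which partition
   the faces; par e is the face containing e. *)
Record mesh (R : realType) (d : nat) := Mesh {
  elt : finType;
  cell : elt -> set 'rV[R]_d;
  face : finType;
  forg : face -> 'rV[R]_d;
  ffrm : face -> 'M[R]_(d.-1, d);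
  fdom : face -> set 'rV[R]_d.-1;
  subface : finType;
  par : subface -> face;
  sdom : subface -> set 'rV[R]_d.-1 }.

Section discretization.
Context {R : realType} {d : nat} (M : mesh R d).
Implicit Types (F : face M) (t : elt M) (e : subface M).
Local Notation h1 := (h1fun R d).
Local Notation V := {ffun subface M -> R^o}.

Definition face_map F (z : 'rV[R]_d.-1) : 'rV[R]_d := forg F + z *m ffrm F.
Definition face_set F := face_map F @` fdom F.

Definition faces t : {set face M} := [set F | `[< face_set F `<=` bdry (cell t) >]].
Definition elts F : {set elt M} := [set t | F \in faces t].

(* gamma is the shape-regularity constant. *)
Definition is_mesh (Omega : set 'rV[R]_d) (H h gamma : R) (Nf : nat) :=
  [/\ (forall t,
        [/\ polyhedral_domain (cell t), lipschitz_domain (cell t),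
            cell t `<=` Omega, diam (cell t) < H &
            exists (x : 'rV[R]_d) (r : R),
              [/\ 0 < r, [set y | enorm (y - x) < r] `<=` cell t &
                  diam (cell t) <= gamma * r]]),
      (forall t t' : elt M, t != t' -> cell t `&` cell t' = set0) /\
        closure Omega = \bigcup_(t in [set: elt M]) closure (cell t),
      [/\ forall F, ffrm F *m (ffrm F)^T = 1%:M /\ polyhedral_domain (fdom F),
          forall F F', F != F' -> face_set F `&` face_set F' = set0,
          forall t, bdry (cell t) = \bigcup_(F in [set` faces t]) closure (face_set F) &
          forall F, (#|elts F| = 1%N /\ face_set F `<=` bdry Omega) \/
                    (#|elts F| = 2%N /\ face_set F `<=` Omega)],
      forall t, (#|faces t| <= Nf)%N &
      [/\ forall e, [/\ polyhedral_domain (sdom e), sdom e `<=` fdom (par e) &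
                        diam (sdom e) <= h],
          forall e e', e != e' -> par e = par e' -> sdom e `&` sdom e' = set0 &
          forall F, closure (fdom F) =
            \bigcup_(e in [set e : subface M | par e = F]) closure (sdom e)]].

(* The trace operators H^1(t) -> L^2(bdry t): the bounded linear extensions of
   the restriction of C^1 functions to the boundary. *)
Definition trace_operator (tr : elt M -> h1 -> 'rV[R]_d -> R) :=
  forall t,
  [/\ forall w, H1 (cell t) w -> forall F, F \in faces t ->
        L2 (fdom F) (tr t w \o face_map F),
      forall a u v, H1 (cell t) u -> H1 (cell t) v -> forall F, F \in faces t ->
        {ae leb d.-1, forall z, fdom F z ->
          tr t (h1_lin a u v) (face_map F z) =
          a * tr t u (face_map F z) + tr t v (face_map F z)},
      exists C : R, forall w, H1 (cell t) w ->
        \sum_(F in faces t) \int[leb d.-1]_(z in fdom F) (tr t w (face_map F z) ^+ 2)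
          <= C * H1sqnorm (cell t) w &
      forall phi, C1 phi -> forall F, F \in faces t ->
        {ae leb d.-1, forall z, fdom F z ->
          tr t (phi, grad phi) (face_map F z) = phi (face_map F z)}].

Section spaces.
Variables (Omega : set 'rV[R]_d) (tr : elt M -> h1 -> 'rV[R]_d -> R).

(* H^{-1/2}(bdry t), the dual of the trace space of H^1(t): the bounded linear
   functionals on H^1(t) which depend only on the trace. *)
Definition Hmhalf t (l : h1 -> R) :=
  [/\ forall a u v, H1 (cell t) u -> H1 (cell t) v ->
        l (h1_lin a u v) = a * l u + l v,
      exists C : R, forall w, H1 (cell t) w ->
        l w ^+ 2 <= C * H1sqnorm (cell t) w &
      forall w, H1 (cell t) w ->
        (forall F, F \in faces t ->
          {ae leb d.-1, forall z, fdom F z -> tr t w (face_map F z) = 0}) ->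
        l w = 0].

(* The normal traces of H(div; Omega): mu t v is the duality (s . n, v) on
   bdry t, defined by Green's formula. *)
Definition Lambda (mu : elt M -> h1 -> R) :=
  exists s q, Hdiv Omega s q /\
    forall t v, H1 (cell t) v ->
      mu t v = \int[leb d]_(x in cell t) (dot (s x) (v.2 x) + q x * v.1 x).

(* The function with value c e on each subface e of bdry t, as a functional. *)
Definition fcst t (c : V) (v : h1) : R :=
  \sum_(e | par e \in faces t)
    c e * \int[leb d.-1]_(z in sdom e) tr t v (face_map (par e) z).

(* An element of Lambda_h is represented by its values: c t e is the value on
   the subface e, seen from t (and is 0 if e is not on bdry t). *)
Definition Lambda_h (c : elt M -> V) :=
  (forall t e, par e \notin faces t -> c t e = 0) /\
  Lambda (fun t => fcst t (c t)).

Definition Lambda_h0 (c : elt M -> V) :=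
  Lambda_h c /\
  forall a : elt M -> R, \sum_t fcst t (c t) (cst (a t), cst 0) = 0.

Definition Lambda_hf (c : elt M -> V) :=
  Lambda_h0 c /\
  forall t F, F \in faces t ->
    \sum_(e | par e == F) c t e * fine (leb d.-1 (sdom e)) = 0.

Definition restr (P : pred (face M)) (c : V) : V :=
  [ffun e => if P (par e) then c e else 0].

(* The two sides see opposite values on an interior face, so that a restriction
   to F is defined up to a sign; Lambda_F contains both signs, and both sides
   of the eigenproblem below are invariant under changing them. *)
Definition Lambda_F F : set V :=
  [set x | exists c t, [/\ Lambda_hf c, F \in faces t & x = restr (pred1 F) (c t)]].

Definition Lambda_Fc t F : set V :=
  [set x | exists c, Lambda_hf c /\
    x = restr (fun F' => (F' \in faces t) && (F' != F)) (c t)].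

(* T, acting on arbitrary data in H^{-1/2}(bdry t) on each element t. *)
Definition solution_operator (A : 'rV[R]_d -> 'M[R]_d)
    (T : elt M -> (h1 -> R) -> h1) :=
  forall t l, Hmhalf t l ->
    H1mean0 (cell t) (T t l) /\
    forall w, H1mean0 (cell t) w ->
      \int[leb d]_(x in cell t) dot ((T t l).2 x *m A x) (w.2 x) = l w.

Variable T : elt M -> (h1 -> R) -> h1.

Definition Tform t (a b : V) : R := fcst t a (T t (fcst t b)).

(* (T_{F^c F^c})^{-1} T_{F^c F} m *)
Definition schur_sol t F (m : V) : V :=
  xget 0 [set w | Lambda_Fc t F w /\
    forall x, Lambda_Fc t F x -> Tform t x w = Tform t x m].

Definition That t F (a b : V) : R :=
  Tform t a b - Tform t a (schur_sol t F b).

(* The sums over the elements having F as a face have two terms if F is an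
   interior face, and one if F is on the boundary of the domain. *)
Definition eigenbasis F (m : nat) (alpha : 'I_m -> R) (psi : m.-tuple V) :=
  [/\ forall i j : 'I_m, (i <= j)%N -> alpha i <= alpha j,
      forall x, Lambda_F F x <-> x \in <<psi>>%VS,
      free psi,
      forall (i : 'I_m) x, Lambda_F F x ->
        \sum_(t in elts F) Tform t x (tnth psi i) =
        alpha i * \sum_(t in elts F) That t F x (tnth psi i) &
      forall i j : 'I_m,
        \sum_(t in elts F) That t F (tnth psi i) (tnth psi j) = (i == j)%:R].

Section stab.
Variables (astab : R) (m : face M -> nat) (alpha : forall F, 'I_(m F) -> R)
  (psi : forall F, (m F).-tuple V).

Definition Lambda_F_tri F : {vspace V} :=
  <<[seq tnth (psi F) i | i <- enum 'I_(m F) & (alpha i < astab)%R]>>%VS.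

Definition Lambda_tri (c : elt M -> V) :=
  Lambda_hf c /\
  forall F t, F \in faces t -> restr (pred1 F) (c t) \in Lambda_F_tri F.

Definition is_Ptri (v : elt M -> h1) (mu : elt M -> V) :=
  Lambda_tri mu /\
  forall nu, Lambda_tri nu ->
    \sum_t Tform t (nu t) (mu t) = \sum_t fcst t (nu t) (v t).
End stab.
End spaces.

(* An element v of H^1(T_H) is given by its restrictions v t; this is the whole
   space since the mesh is finite. *)
Definition H1mesh (v : elt M -> h1) := forall t, H1 (cell t) (v t).

Definition supported_in (K : elt M) (v : elt M -> h1) :=
  forall t, t != K -> {ae leb d, forall x, cell t x -> (v t).1 x = 0}.

(* |w|^2_{H^1_A(S)}, where Ah stands for A^{1/2}. *)
Definition energy (Ah : 'rV[R]_d -> 'M[R]_d) (S : {set elt M})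
    (w : elt M -> h1) : R :=
  \sum_(t in S) \int[leb d]_(x in cell t)
    (enorm ((w t).2 x *m Ah x) ^+ 2).

Fixpoint patches (K : elt M) (j : nat) : {set elt M} :=
  match j with
  | 0 => finset.set0
  | 1 => [set K]%SET
  | k.+1 => [set t | [exists t', (t' \in patches K k) &&
               `[< closure (cell t) `&` closure (cell t') !=set0 >]]]%SET
  end.
End discretization.

(* Main.v *)
(* Fix j >= 1 and let nu be mu set to zero on the faces that touch the patch
   T_j(K).  As v lives on K, nu is orthogonal to T mu.  Written elementwise,
   this bounds the energy of T mu outside T_{j+1}(K) by the couplings
   (mu|_F, T mu) over the faces F between T_j(K) and T_{j+1}(K) \ T_j(K).
   By Young's inequality, the eigenvalue bound T_FF <= astab That_FF and the
   minimality of the Schur complement, each coupling is at most astab times the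
   energy of the two elements sharing F.  Hence, with E_j the energy outside
   T_j(K), E_{j+1} <= Nf astab (E_{j-1} - E_{j+1}), so that
   E_{j+1} <= exp (- 1 / (1 + Nf astab)) E_{j-1}.

   The truncation nu is admissible because the normal traces that are constant
   on subfaces with zero mean on faces are exactly the data with opposite values
   on the two sides of interior faces: testing against C^1 functions separates
   the subfaces, and conversely the elementwise fluxes A grad T mu glue to a
   field of zero divergence. *)

(* Membership in [Lambda_hf] means that a global [H(div)] field exists, whereas the truncation acts
   face by face and comes with no such field; hence the detour through a local description of the
   data. The zero mean on every face serves twice there: it makes the equation of [T] hold against
   all of [H^1], not only against functions of zero mean, and it survives dropping whole faces.

   The eigenproblem compares two energies of the same face data: [T_FF] extends them by zero to the
   rest of the element boundary, while [That_FF] is the least energy over all admissible extensions,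
   and [mu] itself is one of these. Only the sum over the two elements sharing the face is
   controlled, and one of the two lies in the inner patch; so a step of the recursion loses two
   layers, which is the origin of the integer part of (j+1)/2. The factor [Nf] counts the faces
   through which the energy of one element can enter. With N = Nf astab, the rate comes from N/(1+N)
   = 1 - 1/(1+N) <= exp(-1/(1+N)). *)
Require Import Defs.
From HB Require Import structures.
From mathcomp Require Import all_boot all_order all_algebra.
From mathcomp Require Import all_classical all_reals all_analysis.
From mathcomp Require Import measurable_realfun ring lra.
Set Implicit Arguments.
Unset Strict Implicit.
Unset Printing Implicit Defensive.
Import Order.TTheory GRing.Theory Num.Theory.
Import numFieldNormedType.Exports.
Local Open Scope classical_set_scope.
Local Open Scope ring_scope.

(** * Lebesgue measure on row vectors *)

Section rV_topology.
Context {R : realType} {n : nat}.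
Implicit Types (x y a b : 'rV[R]_n) (U : set 'rV[R]_n).

Lemma rV_nbhsP x (P : set 'rV[R]_n) : nbhs x P <->
  exists2 e : R, 0 < e & forall y, (forall i, `|x ord0 i - y ord0 i| < e) -> P y.
Proof.
split=> [/nbhs_ballP[e /= e0 eP]|[e e0 eP]].
  exists e => // y xy; apply: eP; split=> // i j; rewrite [i]ord1; exact: xy.
by apply/nbhs_ballP; exists e => //= y [_ xy]; apply: eP => i; exact: xy.
Qed.

Definition obox a b := [set x : 'rV[R]_n | forall i, a ord0 i < x ord0 i < b ord0 i].

Lemma open_obox a b : open (obox a b).
Proof.
rewrite openE => x xab; apply/rV_nbhsP.
pose e := \big[Num.min/1]_(i < n) Num.min (x ord0 i - a ord0 i) (b ord0 i - x ord0 i).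
have e0 : 0 < e.
  rewrite /e; elim/big_ind: _ => //= [u v u0 v0|i _]; rewrite lt_min ?u0//.
  by have := xab i; rewrite !subr_gt0.
exists e => // y xy i; have := xy i; rewrite ltr_distlC.
have : e <= Num.min (x ord0 i - a ord0 i) (b ord0 i - x ord0 i).
  exact: (bigmin_le 1 i (fun i => Num.min (x ord0 i - a ord0 i) (b ord0 i - x ord0 i))).
by rewrite le_min => /andP[? ?] /andP[? ?]; apply/andP; split; lra.
Qed.

Lemma measurable_obox a b : measurable (obox a b).
Proof.
suff -> : obox a b = \bigcap_(i in [set: 'I_n])
    (rV_coord i @^-1` (`]a ord0 i, b ord0 i[%classic : set (measurableTypeR R))).
  apply: fin_bigcap_measurable; first exact: finite_finset.
  move=> i _; rewrite -[X in measurable X]setTI; apply: (@measurable_rV_coord R n i measurableT).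
  exact: measurable_itv.
apply/seteqP; split=> x /=.
  by move=> H i _ /=; rewrite in_itv/=.
by move=> H i; have := H i Logic.I; rewrite /= in_itv/=.
Qed.

Definition cbox a b := [set x : 'rV[R]_n | forall i, a ord0 i <= x ord0 i <= b ord0 i].

(** Rational corners make the boxes countable, for measurability and for almost-everywhere
    arguments; the closed box inside [U] is what makes a bump on the open box a test function of
    [U]. *)
Lemma open_rat_box U x : open U -> U x -> exists p : 'rV[rat]_n * 'rV[rat]_n,
  obox (map_mx ratr p.1) (map_mx ratr p.2) x /\
  cbox (map_mx ratr p.1) (map_mx ratr p.2) `<=` U.
Proof.
rewrite openE => /[apply] /rV_nbhsP[e e0 eU].
have hq i : exists q : rat * rat,
  (x ord0 i - e < ratr q.1 < x ord0 i) /\ (x ord0 i < ratr q.2 < x ord0 i + e).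
  have [q1] := rat_in_itvoo (ltr_pwDr (e0) (lexx (x ord0 i - e))).
  rewrite subrK => /itvP q1P.
  have [q2 /itvP q2P] := rat_in_itvoo (ltr_pwDr (e0) (lexx (x ord0 i))).
  by exists (q1, q2); rewrite /= !q1P !q2P.
have [q hq'] := choice hq.
exists (\row_i (q i).1, \row_i (q i).2); split=> [i|y yq] /=.
  by rewrite !mxE; have [/andP[_ ->] /andP[->]] := hq' i.
apply: eU => i; have := yq i; rewrite /= !mxE => /andP[y1 y2].
have [/andP[h1 h2] /andP[h3 h4]] := hq' i.
by rewrite ltr_distlC; apply/andP; split; lra.
Qed.

Lemma obox_cbox a b : obox a b `<=` cbox a b.
Proof. by move=> x xab i; have /andP[/ltW -> /ltW ->] := xab i. Qed.

Lemma open_rat_obox U x : open U -> U x -> exists p : 'rV[rat]_n * 'rV[rat]_n,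
  obox (map_mx ratr p.1) (map_mx ratr p.2) x /\
  obox (map_mx ratr p.1) (map_mx ratr p.2) `<=` U.
Proof.
move=> oU /(open_rat_box oU)[p [px pU]]; exists p; split=> //.
by apply: subset_trans pU; exact: obox_cbox.
Qed.

(** The sigma-algebra is generated by the coordinates, so an open set has to be exhausted by
    countably many boxes. *)
Lemma measurable_open_rV U : open U -> measurable U.
Proof.
move=> oU.
pose F (p : 'rV[rat]_n * 'rV[rat]_n) : set 'rV[R]_n :=
  if `[< obox (map_mx ratr p.1) (map_mx ratr p.2) `<=` U >] then
    obox (map_mx ratr p.1) (map_mx ratr p.2) else set0.
suff -> : U = \bigcup_p F p.
  apply: countable_bigcupT_measurable => [|p]; first exact: countableP.
  by rewrite /F; case: ifP => // _; exact: measurable_obox.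
apply/seteqP; split=> [x Ux|x [p _]].
  have [p [px pU]] := open_rat_obox oU Ux.
  by exists p => //; rewrite /F asboolT.
by rewrite /F; case: ifP => // /asboolP pU /pU.
Qed.

Lemma measurable_closed_rV U : closed U -> measurable U.
Proof.
move=> cU; rewrite -[U]setCK; apply: measurableC; apply: measurable_open_rV.
by rewrite openC.
Qed.

Lemma continuous_measurable_rV (f : 'rV[R]_n -> R) (D : set 'rV[R]_n) :
  continuous f -> measurable D -> measurable_fun D f.
Proof.
move=> cf mD; apply: (@measurable_funS _ _ _ _ setT) => //.
apply: (measurability _ (@RGenOpens.measurableE R)).
move=> _ [_ [a [b ->] <-]]; rewrite setTI.
by apply: measurable_open_rV; apply: open_comp => //; exact: interval_open.
Qed.

Lemma bounded_set_obox U : bounded_set U ->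
  exists M : R, U `<=` obox (const_mx (- M)) (const_mx M).
Proof.
case=> M [_ /(_ (M + 1))]; rewrite ltrDl ltr01 => /(_ isT) UM.
exists (M + 2) => x Ux i; rewrite !mxE -ltr_norml.
have := UM x Ux; rewrite /= => xM.
apply: (@le_lt_trans _ _ `|x|); last by rewrite (le_lt_trans xM)// ltrD2l; lra.
rewrite [`|x|]mx_normrE.
exact: (le_bigmax _ (fun ij : 'I_1 * 'I_n => `|x ij.1 ij.2|) (ord0, i)).
Qed.

End rV_topology.

Section leb_sets.
Context {R : realType}.
Local Notation lebT := (@lebesgue_measure R).

Lemma leb_succ n (A : set 'rV[R]_n.+1) :
  leb n.+1 A = (lebT \x leb n)%E (@rV_cons R n @^-1` A).
Proof. by []. Qed.

Lemma rV_cons_coord0 n (p : measurableTypeR R * 'rV[R]_n) :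
  rV_cons p ord0 ord0 = p.1.
Proof.
transitivity ((p.1%:M : 'M[R]_1) ord0 ord0); last by rewrite mxE.
apply: etrans (row_mxEl (p.1%:M : 'M[R]_1) p.2 ord0 ord0).
by congr (fun_of_matrix _ _ _); exact/val_inj.
Qed.

Lemma rV_cons_coordS n (p : measurableTypeR R * 'rV[R]_n) (i : 'I_n) :
  rV_cons p ord0 (lift ord0 i) = p.2 ord0 i.
Proof.
apply: etrans (row_mxEr (p.1%:M : 'M[R]_1) p.2 ord0 i).
by congr (fun_of_matrix _ _ _); exact/val_inj.
Qed.

Lemma leb_obox n (a b : 'rV[R]_n) : (forall i, a ord0 i <= b ord0 i) ->
  leb n (obox a b) = (\prod_i (b ord0 i - a ord0 i))%:E.
Proof.
elim: n a b => [|n IH] a b ab.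
  rewrite big_ord0 /leb/= diracE mem_set//.
  by move=> i; case: i.
rewrite leb_succ.
have -> : @rV_cons R n @^-1` obox a b =
  (`]a ord0 ord0, b ord0 ord0[%classic : set (measurableTypeR R)) `*`
  obox (\row_i a ord0 (lift ord0 i)) (\row_i b ord0 (lift ord0 i)).
  apply/seteqP; split=> -[s u] /=; rewrite in_itv/=.
    move=> H; split; first by have := H ord0; rewrite rV_cons_coord0.
    by move=> i; have := H (lift ord0 i); rewrite rV_cons_coordS !mxE.
  move=> [H0 H] i; case: (unliftP ord0 i) => [k|] ->.
    by rewrite rV_cons_coordS/=; have := H k; rewrite !mxE.
  by rewrite rV_cons_coord0.
rewrite product_measure1E/=; [|exact: measurable_itv|exact: measurable_obox].
rewrite IH; last by move=> i; rewrite !mxE; exact: ab.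
rewrite lebesgue_measure_itv/= big_ord_recl.
under eq_bigr do rewrite !mxE.
case: ifP; rewrite ?lte_fin.
  by rewrite -EFinD EFinM.
move=> /negbT; rewrite -leNgt => ba.
have -> : b ord0 ord0 = a ord0 ord0 by apply/eqP; rewrite eq_le ba ab.
by rewrite subrr mul0r mul0e.
Qed.

Lemma leb_bounded_lty n (U : set 'rV[R]_n) :
  measurable U -> bounded_set U -> (leb n U < +oo)%E.
Proof.
move=> mU /bounded_set_obox[M UM].
have [M0|M0] := leP 0 M.
  apply: (@le_lt_trans _ _ (leb n (obox (const_mx (- M)) (const_mx M)))).
    by apply: le_measure => //; rewrite inE//; exact: measurable_obox.
  by rewrite leb_obox ?ltry// => i; rewrite !mxE; lra.
(* A negative [M] makes the box empty, except in dimension 0, where it is the whole one-point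
   space. *)
case: n => [|n] in U mU UM *.
  by rewrite /leb/= diracE ltry.
suff -> : U = set0 by rewrite measure0 ltry.
by rewrite -subset0 => x /UM/(_ ord0); rewrite !mxE => /andP[]; lra.
Qed.

Lemma leb_open_gt0 n (U : set 'rV[R]_n) : open U -> U !=set0 -> (0 < leb n U)%E.
Proof.
move=> oU [x Ux].
have [p [px pU]] := open_rat_obox oU Ux.
apply: (@lt_le_trans _ _ (leb n (obox (map_mx ratr p.1) (map_mx ratr p.2)))).
  rewrite leb_obox; last by move=> i; have /andP[/ltW + /ltW] := px i; exact: le_trans.
  rewrite lte_fin; apply: prodr_gt0 => i _; rewrite subr_gt0.
  by have /andP[] := px i; exact: lt_trans.
apply: le_measure => //; rewrite inE; first exact: measurable_obox.
exact: measurable_open_rV.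
Qed.

Lemma continuous_dot n (p : 'rV[R]_n) : continuous (dot p).
Proof.
apply: (@continuous_big R _ +%R 0 xpredT _ _ _
  (fun i (x : 'rV[R]_n) => p ord0 i * x ord0 i)) => [|i _ x].
  by move=> z; apply: cvgD; [exact: cvg_fst|exact: cvg_snd].
by apply: (@continuousM _ _ (cst (p ord0 i)) (fun y : 'rV[R]_n => y ord0 i));
  [exact: cst_continuous|exact: coord_continuous].
Qed.

Lemma measurable_hyperplane n (q : 'rV[R]_n * R) : measurable (hyperplane q).
Proof.
apply: measurable_closed_rV.
rewrite (_ : hyperplane q = (dot q.1) @^-1` [set q.2])//.
apply: preimage_closed; last exact: closed_eq.
by move=> x _; exact: continuous_dot.
Qed.

(** Fubini along the first coordinate: if some other coefficient is nonzero, every slice is a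
    hyperplane of one dimension less; otherwise a single slice is nonempty, and one point is null on
    the line. *)
Lemma leb_hyperplane n (q : 'rV[R]_n * R) : q.1 != 0 -> leb n (hyperplane q) = 0.
Proof.
elim: n q => [|n IH] [p c] /= p0.
  by move/eqP: p0; case; apply/rowP => -[].
rewrite leb_succ.
set B := _ @^-1` _.
have mB : measurable B.
  rewrite -[B]setTI; apply: measurable_rV_cons => //; exact: measurable_hyperplane.
pose p' : 'rV[R]_n := \row_i p ord0 (lift ord0 i).
have dE (s : measurableTypeR R) (u : 'rV[R]_n) :
    dot p (rV_cons (s, u)) = p ord0 ord0 * s + dot p' u.
  rewrite /dot big_ord_recl rV_cons_coord0; congr (_ + _).
  by apply: eq_bigr => i _; rewrite rV_cons_coordS mxE.
have xB (s : measurableTypeR R) : xsection B s = hyperplane (p', c - p ord0 ord0 * s).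
  apply/seteqP; split=> u; rewrite /xsection /B /hyperplane /= ?inE/= dE => H.
    by rewrite -H addrC addKr.
  by rewrite H subrKC.
rewrite /product_measure1.
under eq_integral do rewrite /= xB.
have [p'0|p'0] := eqVneq p' 0; last first.
  by under eq_integral do rewrite (IH (p', _) p'0); rewrite integral0.
have p00 : p ord0 ord0 != 0.
  apply: contra p0 => /eqP p00; apply/eqP/rowP => i; rewrite mxE.
  case: (unliftP ord0 i) => [k|] ->//.
  by move/rowP: p'0 => /(_ k); rewrite !mxE.
pose N : set (measurableTypeR R) := [set c / p ord0 ord0].
transitivity (\int[lebT]_(x in ~` N) 0%E)%E; last by rewrite integral0.
have mN : measurable N by exact: measurable_set1.
have mf : measurable_fun setT
  (fun s : measurableTypeR R => leb n (hyperplane (p', c - p ord0 ord0 * s))).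
  rewrite (_ : (fun _ => _) = (leb n \o xsection B)).
    exact: measurable_fun_xsection.
  by apply/funext => s /=; rewrite xB.
rewrite (ge0_negligible_integral mN)//; last exact: (lebesgue_measure_set1 (c / p ord0 ord0)).
rewrite setTD; apply: eq_integral => s; rewrite inE => sN.
suff -> : hyperplane (p', c - p ord0 ord0 * s) = set0 by rewrite measure0.
rewrite -subset0 => u; rewrite /hyperplane /= p'0 /dot big1 => [H|i _]; last first.
  by rewrite mxE mul0r.
apply: sN; rewrite /N/=; apply/(mulIf p00); rewrite divfK//.
by apply/esym/eqP; rewrite -subr_eq0 mulrC -H.
Qed.

End leb_sets.

(** * C^1 functions *)

Section line_derivative.
Context {R : realType} {n : nat}.
Implicit Types (x v z : 'rV[R]_n) (f : 'rV[R]_n -> R).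

Lemma is_derive_line f z v (t df : R) :
  is_derive (z + t *: v) v f df -> is_derive t 1 (fun s : R => f (z + s *: v)) df.
Proof.
move=> [df1 df2].
have E : (fun h : R => h^-1 *: (((fun s : R => f (z + s *: v)) \o shift t) (h *: 1)
      - f (z + t *: v))) =
    (fun h => h^-1 *: ((f \o shift (z + t *: v)) (h *: v) - f (z + t *: v))).
  apply/funext => h /=; congr (_ *: (f _ - _)).
  by rewrite scalerDl [h *: 1]mulr1 addrCA.
by split; [rewrite /derivable E|rewrite /derive E].
Qed.

(** Serves [pos2]: a quadratic remainder bound gives its derivative without differentiating a
    maximum. *)
Lemma is_derive_quad f x v (L C : R) :
  (forall h, `|f (h *: v + x) - f x - h * L| <= C * h ^+ 2) -> is_derive x v f L.
Proof.
move=> fC.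
have C0 : 0 <= C.
  have := le_trans (normr_ge0 _) (fC 1); by rewrite expr1n mulr1.
suff cf : (fun h => h^-1 *: ((f \o shift x) (h *: v) - f x)) @ 0^' --> L.
  by split; [apply/cvg_ex; exists L|exact/cvg_lim].
apply/cvgrPdist_lt => e e0; near=> h.
have h0 : h != 0 by near: h; exact: nbhs_dnbhs_neq.
have hn : 0 < `|h| by rewrite normr_gt0.
rewrite -(ltr_pM2l hn) -normrM mulrBr /= /shift /= mulrA divff// mul1r distrC.
apply: (le_lt_trans (fC h)).
rewrite -real_normK ?num_real// mulrC expr2 -mulrA ltr_pM2l//.
apply: (@le_lt_trans _ _ (`|h| * (C + 1))).
  by rewrite ler_pM2l// lerDl.
rewrite -ltr_pdivlMr; last exact: ltr_wpDl.
near: h.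
by apply: dnbhs0_lt; apply: divr_gt0 => //; exact: ltr_wpDl.
Unshelve. all: by end_near. Qed.

End line_derivative.

Section C1_functions.
Context {R : realType} {n : nat}.
Implicit Types (x v y z : 'rV[R]_n) (f g : 'rV[R]_n -> R) (i : 'I_n).
Local Notation e_ := (delta_mx ord0).

Lemma C1_is_derive f i x : C1 f -> is_derive x (e_ i) f (partial i f x).
Proof. by move=> Cf; split => //; have [] := Cf i. Qed.

Lemma C1_intro f (df : 'I_n -> 'rV[R]_n -> R) :
  (forall i x, is_derive x (e_ i) f (df i x)) ->
  (forall i, continuous (df i)) -> C1 f /\ forall i x, partial i f x = df i x.
Proof.
move=> fdf cdf; have E i x : partial i f x = df i x by exact: derive_val.
split=> // i; split=> [x|]; first exact: ex_derive.
by rewrite (_ : partial i f = df i)//; apply/funext.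
Qed.

Lemma segment_lip (h dh : R -> R) (s B : R) :
  (forall t : R, is_derive t 1 h (dh t)) -> (forall t, `|t| <= `|s| -> `|dh t| <= B) ->
  `|h s - h 0| <= B * `|s|.
Proof.
move=> hdh dhB.
have ch (a b : R) : {within `[a, b], continuous h}.
  by apply: derivable_within_continuous => t _; exact: ex_derive.
have [s0|s0|->] := ltgtP s 0.
- have [c] := MVT s0 (fun t _ => hdh t) (@ch _ _).
  rewrite in_itv/= => /andP[sc c0] E.
  rewrite distrC E sub0r normrM normrN ler_wpM2r//; apply: dhB.
  by rewrite !ltr0_norm// lerN2 ltW.
- have [c] := MVT s0 (fun t _ => hdh t) (@ch _ _).
  rewrite in_itv/= => /andP[c0 cs] E.
  rewrite E subr0 normrM ler_wpM2r//; apply: dhB.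
  by rewrite !gtr0_norm// ltW.
- by rewrite subrr normr0 mulr0.
Qed.

(* [C1] does not assume continuity: go from x to y one coordinate at a time and
   apply the mean value theorem to each step. *)
Lemma C1_continuous f : C1 f -> continuous f.
Proof.
move=> Cf x.
have rB i : exists rB : R * R, 0 < rB.1 /\ forall y,
    (forall j, `|x ord0 j - y ord0 j| < rB.1) -> `|partial i f y| <= rB.2.
  have [_ /(_ x)/cvgr_dist_lt/(_ _ ltr01)] := Cf i.
  move=> /rV_nbhsP[r r0 rP]; exists (r, `|partial i f x| + 1); split => //= y /rP xy.
  rewrite -lerBlDl; apply: le_trans (ltW xy).
  by rewrite distrC lerB_dist.
have [rB' {}rB] := choice rB.
pose r := \big[Num.min/1]_(i < n) (rB' i).1.
pose B := \sum_(i < n) `|(rB' i).2|.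
have r0 : 0 < r.
  by rewrite /r; elim/big_ind: _ => //= [u v u0 v0|i _]; [rewrite lt_min u0|have [] := rB i].
have PB i y : (forall j, `|x ord0 j - y ord0 j| < r) -> `|partial i f y| <= B.
  move=> xy; have [_ /(_ y)H] := rB i; apply: (@le_trans _ _ `|(rB' i).2|).
    apply: le_trans (ler_norm _); apply: H => j; apply: lt_le_trans (xy j) _.
    exact: (bigmin_le 1 i (fun i => (rB' i).1)).
  by rewrite /B (bigD1 i)//= lerDl sumr_ge0.
apply/(@cvgrPdist_lt _ _ _ (nbhs x) _ f) => e e0; apply/rV_nbhsP.
have B0 : 0 <= B by rewrite sumr_ge0.
have K0 : 0 < n%:R * B + 1 by rewrite ltr_wpDl// mulr_ge0.
exists (Num.min r (e / (n%:R * B + 1))) => [|y xy].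
  by rewrite lt_min r0 divr_gt0.
pose z (k : nat) : 'rV[R]_n := \row_j if (j < k)%N then y ord0 j else x ord0 j.
have z0 : z 0%N = x by apply/rowP => j; rewrite mxE.
have zn : z n = y by apply/rowP => j; rewrite mxE ltn_ord.
have -> : `|f x - f y| = `|\sum_(i < n) (f (z (i : nat).+1) - f (z i))|.
  by rewrite -(big_mkord xpredT (fun i : nat => f (z i.+1) - f (z i)))
    (telescope_sumr (fun i : nat => f (z i)))// z0 zn distrC.
apply: (le_lt_trans (ler_norm_sum _ _ _)).
apply: (@le_lt_trans _ _ (\sum_(i < n) B * Num.min r (e / (n%:R * B + 1)))); last first.
  rewrite sumr_const card_ord -[X in X < _]mulr_natl mulrA.
  apply: (@le_lt_trans _ _ (n%:R * B * (e / (n%:R * B + 1)))).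
    by rewrite ler_wpM2l ?mulr_ge0// ge_min lexx orbT.
  by rewrite mulrCA gtr_pMr// ltr_pdivrMr// mul1r ltrDl.
apply: ler_sum => i _.
pose s := y ord0 i - x ord0 i.
have zS t : z i + t *: e_ i = \row_j if (j < i)%N then y ord0 j
    else if j == i then x ord0 j + t else x ord0 j.
  apply/rowP => j; rewrite !mxE eqxx/=.
  case: ltngtP => [ji|ij|/val_inj ->]; rewrite ?eqxx ?mulr1 ?ltnn//.
  - by rewrite (negbTE (_ : j != i)) ?mulr0 ?addr0// -val_eqE/= ltn_eqF.
  - by rewrite (negbTE (_ : j != i)) ?mulr0 ?addr0// -val_eqE/= gtn_eqF.
have -> : z i.+1 = z i + s *: e_ i.
  rewrite zS; apply/rowP => j; rewrite !mxE ltnS leq_eqVlt -val_eqE/=.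
  by case: ltngtP => //= /val_inj ->; rewrite /s subrKC.
have fz : f (z i) = f (z i + 0 *: e_ i) by rewrite scale0r addr0.
rewrite [X in _ - X]fz.
apply: le_trans (_ : B * `|s| <= _); last first.
  by rewrite ler_wpM2l// /s distrC ltW.
have := @segment_lip (fun t => f (z i + t *: e_ i))
  (fun t => partial i f (z i + t *: e_ i)) s B; apply.
  by move=> t; apply: is_derive_line; exact: C1_is_derive.
move=> t ts; apply: PB => j; rewrite zS mxE.
have xyr k : `|x ord0 k - y ord0 k| < r.
  by have := xy k; rewrite lt_min => /andP[].
case: ltnP => // _; case: eqP => [->|_]; last by rewrite subrr normr0.
rewrite opprD addNKr normrN; apply: le_lt_trans ts _.
by rewrite /s distrC.
Qed.

Lemma C1_cst (c : R) : C1 (cst c : 'rV[R]_n -> R) /\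
  forall i x, partial i (cst c) x = 0.
Proof.
by apply: (@C1_intro _ (fun _ => cst 0)) => i; exact: cst_continuous.
Qed.

Lemma C1M f g : C1 f -> C1 g -> C1 (fun x => f x * g x) /\
  forall i x, partial i (fun x => f x * g x) x =
    f x * partial i g x + g x * partial i f x.
Proof.
move=> Cf Cg.
apply: (@C1_intro _ (fun i x => f x * partial i g x + g x * partial i f x)) => i.
  by move=> x; apply: is_deriveM; exact: C1_is_derive.
have [_ cf] := Cf i; have [_ cg] := Cg i.
move=> x; apply: (@continuousD _ _ _ (f \* partial i g) (g \* partial i f)).
  by apply: continuousM; [exact: C1_continuous|exact: cg].
by apply: continuousM; [exact: C1_continuous|exact: cf].
Qed.

Lemma C1B f g : C1 f -> C1 g -> C1 (fun x => f x - g x) /\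
  forall i x, partial i (fun x => f x - g x) x = partial i f x - partial i g x.
Proof.
move=> Cf Cg.
apply: (@C1_intro _ (fun i x => partial i f x - partial i g x)) => i.
  by move=> x; apply: is_deriveB; exact: C1_is_derive.
have [_ cf] := Cf i; have [_ cg] := Cg i.
by move=> x; apply: (@continuousB _ _ _ (partial i f) (partial i g)); [exact: cf|exact: cg].
Qed.

Lemma C1_prod I (s : seq I) (F : I -> 'rV[R]_n -> R) : (forall k, C1 (F k)) ->
  C1 (fun x => \prod_(k <- s) F k x).
Proof.
move=> CF; elim: s => [|k s IH].
  rewrite (_ : (fun _ => _) = cst 1); first exact: (C1_cst 1).1.
  by apply/funext => x; rewrite big_nil.
rewrite (_ : (fun _ => _) = fun x => F k x * \prod_(k <- s) F k x).
  exact: (C1M _ _).1.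
by apply/funext => x; rewrite big_cons.
Qed.

Lemma C1X f k : C1 f -> C1 (fun x => f x ^+ k).
Proof.
move=> Cf; elim: k => [|k IH].
  by rewrite (_ : (fun _ => _) = cst 1)//; exact: (C1_cst 1).1.
by under eq_fun do rewrite exprS; exact: (C1M _ _).1.
Qed.

(** The squared positive part is C^1 and nonzero exactly for positive arguments; products of such
    factors are bumps smooth enough for [test_fun]. *)
Definition pos2 (s : R) := Num.max s 0 ^+ 2.

Lemma pos2_quad (s t : R) : `|pos2 (s + t) - pos2 s - t * (2 * Num.max s 0)| <= t ^+ 2.
Proof.
rewrite /pos2 ler_norml /Num.max; case: ltP => s1; case: ltP => s2; apply/andP; split; nra.
Qed.

Lemma pos2_C1 i (e a : R) : C1 (fun x => pos2 (e * x ord0 i - a)).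
Proof.
apply: (proj1 (@C1_intro _
  (fun j x => e * (j == i)%:R * (2 * Num.max (e * x ord0 i - a) 0)) _ _)) => j.
  move=> x; apply: (@is_derive_quad _ _ _ _ _ _ ((e * (j == i)%:R) ^+ 2)) => h.
  rewrite !mxE eqxx/= eq_sym.
  move: (x ord0 i) ((j == i)%:R : R) => y d.
  have -> : e * (h * d + y) - a = e * y - a + h * (e * d) by ring.
  have -> : h * (e * d * (2 * Num.max (e * y - a) 0)) =
    h * (e * d) * (2 * Num.max (e * y - a) 0) by ring.
  have -> : (e * d) ^+ 2 * h ^+ 2 = (h * (e * d)) ^+ 2 by ring.
  exact: pos2_quad.
move=> x; apply: (@continuousM _ _ (cst (e * (j == i)%:R))
  (fun x => 2 * Num.max (e * x ord0 i - a) 0)); first exact: cst_continuous.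
apply: (@continuousM _ _ (cst 2) (fun x => Num.max (e * x ord0 i - a) 0)).
  exact: cst_continuous.
apply: (@continuous_max _ _ (fun x => e * x ord0 i - a) (cst 0)); last exact: cst_continuous.
apply: (@continuousB _ _ _ (fun x => e * x ord0 i) (cst a)); last exact: cst_continuous.
apply: (@continuousM _ _ (cst e) (fun x => x ord0 i)); first exact: cst_continuous.
exact: coord_continuous.
Qed.

End C1_functions.

(** * Square integrable functions *)

Section integration_lemmas.
Context d (T : measurableType d) {R : realType} (mu : {measure set T -> \bar R}).
Variables (D : set T) (mD : measurable D).
Implicit Types f g : T -> R.

Lemma Rintegral_ae_eq f g : measurable_fun D f -> measurable_fun D g ->
  {ae mu, forall x, D x -> f x = g x} ->
  \int[mu]_(x in D) f x = \int[mu]_(x in D) g x.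
Proof.
move=> mf mg fg; rewrite /Rintegral; congr fine.
apply: ae_eq_integral => //; [exact/measurable_EFinP|exact/measurable_EFinP|].
by apply: filterS fg => x fgx Dx; rewrite fgx.
Qed.

Lemma Rintegral_sum (I : Type) (s : seq I) (P : pred I) (f : I -> T -> R) :
  (forall i, P i -> mu.-integrable D (EFin \o f i)) ->
  \int[mu]_(x in D) (\sum_(i <- s | P i) f i x) =
    \sum_(i <- s | P i) \int[mu]_(x in D) f i x.
Proof.
move=> fi; elim: s => [|i s IH].
  under eq_Rintegral do rewrite big_nil.
  by rewrite big_nil Rintegral_cst// mul0r.
under eq_Rintegral do rewrite big_cons.
rewrite big_cons; case: ifPn => // Pi; rewrite RintegralD ?IH//; first exact: fi.
by have := integrable_sum mD s fi; under eq_fun do rewrite sumEFin.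
Qed.

Lemma ae_le_integrable f g : measurable_fun D f ->
  {ae mu, forall x, D x -> `|f x| <= `|g x|} ->
  mu.-integrable D (EFin \o g) -> mu.-integrable D (EFin \o f).
Proof.
move=> mf fg /integrableP[mg goo]; apply/integrableP; split.
  exact/measurable_EFinP.
apply: le_lt_trans goo; apply: ae_ge0_le_integral => //.
- by apply: measurableT_comp => //; exact/measurable_EFinP.
- by apply: measurableT_comp.
Qed.

Lemma integrableZl_EFin f (a : R) : mu.-integrable D (EFin \o f) ->
  mu.-integrable D (EFin \o (fun x => a * f x)).
Proof. by move=> /(integrableZl mD a); apply: eq_integrable. Qed.

Lemma integrableD_EFin f g : mu.-integrable D (EFin \o f) ->
  mu.-integrable D (EFin \o g) -> mu.-integrable D (EFin \o (fun x => f x + g x)).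
Proof. by move=> fi gi; apply: eq_integrable (integrableD mD fi gi). Qed.

Lemma integrableB_EFin f g : mu.-integrable D (EFin \o f) ->
  mu.-integrable D (EFin \o g) -> mu.-integrable D (EFin \o (fun x => f x - g x)).
Proof. by move=> fi gi; apply: eq_integrable (integrableB mD fi gi). Qed.

(** This is [L2] for an arbitrary measure; the two are convertible, so the lemmas below apply to
    [L2] as they stand. *)
Definition sqint f := measurable_fun D f /\ mu.-integrable D (fun x => (f x ^+ 2)%:E).

Lemma sqint_prod f g : sqint f -> sqint g ->
  mu.-integrable D (EFin \o (fun x => f x * g x)).
Proof.
move=> [mf f2] [mg g2].
apply: (@le_integrable _ _ _ mu D mD _ (fun x => (f x ^+ 2)%:E + (g x ^+ 2)%:E)%E).
- by apply/measurable_EFinP; exact: measurable_funM.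
- move=> x Dx; rewrite /= lee_fin [leRHS]ger0_norm ?addr_ge0 ?sqr_ge0//.
  rewrite ler_norml; apply/andP; split; nra.
- exact: integrableD.
Qed.

Lemma sqintD f g : sqint f -> sqint g -> sqint (fun x => f x + g x).
Proof.
move=> sf sg; have [mf f2] := sf; have [mg g2] := sg.
split; first exact: measurable_funD.
have fg := sqint_prod sf sg.
have := integrableD mD (integrableD mD f2 g2) (integrableZl mD 2 fg).
by apply: eq_integrable => // x _; rewrite /= -EFinM -!EFinD; congr EFin; ring.
Qed.

Lemma sqintZ (a : R) f : sqint f -> sqint (fun x => a * f x).
Proof.
move=> [mf f2]; split; first exact: measurable_funM.
have := integrableZl mD (a ^+ 2) f2.
by apply: eq_integrable => // x _; rewrite /= -EFinM exprMn.
Qed.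

Lemma sqint_sum (I : Type) (s : seq I) (P : pred I) (f : I -> T -> R) :
  (forall i, P i -> sqint (f i)) -> sqint (fun x => \sum_(i <- s | P i) f i x).
Proof.
move=> sf; elim: s => [|i s IH].
  under eq_fun do rewrite big_nil; split; first exact: measurable_cst.
  by apply: eq_integrable (integrable0 _ _) => // x _; rewrite /= expr0n.
under eq_fun do rewrite big_cons.
by case Pi: (P i) => //; apply: sqintD => //; exact: sf.
Qed.

Lemma sqint_ae_bounded (b f : T -> R) (C : R) : measurable_fun D b ->
  {ae mu, forall x, D x -> `|b x| <= C} -> sqint f -> sqint (fun x => b x * f x).
Proof.
move=> mb bC [mf f2]; split; first exact: measurable_funM.
apply: (@ae_le_integrable _ (fun x => C ^+ 2 * f x ^+ 2)).
- by apply: measurable_funX; exact: measurable_funM.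
- apply: filterS bC => x H Dx; rewrite (ger0_norm (sqr_ge0 _)) ger0_norm; last by apply: mulr_ge0; exact: sqr_ge0.
  rewrite exprMn; apply: ler_wpM2r; first exact: sqr_ge0.
  by have := H Dx; rewrite ler_norml => /andP[? ?]; nra.
- exact: integrableZl_EFin.
Qed.

Hypothesis muD : (mu D < +oo)%E.

Lemma integrable_cst_fin (a : R) : mu.-integrable D (EFin \o cst a).
Proof.
apply: measurable_bounded_integrable => //.
by exists `|a|; split; [exact: num_real|move=> M aM x _; exact: ltW].
Qed.

Lemma sqint_cst (a : R) : sqint (cst a).
Proof.
split; first exact: measurable_cst.
exact: (integrable_cst_fin (a ^+ 2)).
Qed.

Lemma sqint_integrable f : sqint f -> mu.-integrable D (EFin \o f).
Proof.
move=> sf; have := sqint_prod sf (sqint_cst 1).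
by apply: eq_integrable => // x _; rewrite /= mulr1.
Qed.

(** Cauchy-Schwarz against the constant 1: the integral of [(f - a)^2] is nonnegative for every [a],
    and the mean of [f] is the best choice of [a]. A null [D] is treated apart, the mean being
    undefined there. *)
Lemma Rintegral_sqr_le f : sqint f ->
  (\int[mu]_(x in D) f x) ^+ 2 <= fine (mu D) * \int[mu]_(x in D) (f x ^+ 2).
Proof.
move=> sf; have fi := sqint_integrable sf; have [mf f2] := sf.
set I := \int[mu]_(x in D) f x; set J := \int[mu]_(x in D) (f x ^+ 2).
set m := fine (mu D).
have m0 : 0 <= m by rewrite fine_ge0.
have key a : 0 <= J - 2 * a * I + a ^+ 2 * m.
  have -> : J - 2 * a * I + a ^+ 2 * m = \int[mu]_(x in D) ((f x - a) ^+ 2).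
    have -> : a ^+ 2 * m = \int[mu]_(x in D) (cst (a ^+ 2) x).
      by rewrite Rintegral_cst.
    have -> : 2 * a * I = \int[mu]_(x in D) (2 * a * f x) by rewrite RintegralZl.
    rewrite -RintegralB//; last exact: integrableZl_EFin.
    rewrite -RintegralD//; last exact: integrable_cst_fin.
      by apply: eq_Rintegral => x _; rewrite /=; ring.
    by apply: integrableB_EFin => //; exact: integrableZl_EFin.
  by apply: Rintegral_ge0 => x _; rewrite sqr_ge0.
have J0 : 0 <= J by apply: Rintegral_ge0 => x _; rewrite sqr_ge0.
have [m00|m00] := eqVneq m 0.
  suff -> : I = 0 by rewrite expr0n mulr_ge0.
  have muD0 : mu D = 0%E.
    have muf : mu D \is a fin_num by rewrite ge0_fin_numE.
    by rewrite -(fineK muf) -/m m00.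
  rewrite /I /Rintegral null_set_integral//.
  exact/measurable_EFinP.
have mp : 0 < m by rewrite lt_def m00.
have := key (I / m).
have -> : J - 2 * (I / m) * I + (I / m) ^+ 2 * m = (m * J - I ^+ 2) / m.
  by field.
by rewrite pmulr_lge0 ?invr_gt0// subr_ge0.
Qed.

End integration_lemmas.

Section continuous_integrable.
Context {R : realType}.

Lemma closed_cbox n (a b : 'rV[R]_n) : closed (cbox a b).
Proof.
rewrite (_ : cbox a b = \bigcap_(i in [set: 'I_n])
   ((fun x : 'rV[R]_n => x ord0 i) @^-1` `[a ord0 i, b ord0 i]%classic)).
  apply: closed_bigI => i _; apply: preimage_closed; last exact: interval_closed.
  by move=> x _; exact: coord_continuous.
apply/seteqP; split=> x /=.
  by move=> H i _ /=; rewrite in_itv/=.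
by move=> H i; have := H i Logic.I; rewrite /= in_itv/=.
Qed.

Lemma compact_cbox n (a b : 'rV[R]_n) : compact (cbox a b).
Proof.
rewrite (_ : cbox a b = [set v : 'rV[R]_n | forall i,
  (fun i => `[a ord0 i, b ord0 i]%classic) i (v ord0 i)]).
  have := @rV_compact R n (fun i => `[a ord0 i, b ord0 i]%classic); apply=> i.
  exact: segment_compact.
apply/seteqP; split=> x /= H i; have := H i; by rewrite /= in_itv/=.
Qed.

Lemma continuous_bounded_cbox n (a b : 'rV[R]_n) (g : 'rV[R]_n -> R) :
  continuous g -> exists C, forall x, cbox a b x -> `|g x| <= C.
Proof.
move=> cg.
have : compact (g @` cbox a b).
  by apply: continuous_compact; [exact: continuous_subspaceT|exact: compact_cbox].
move=> /compact_bounded [M [_ /(_ (M + 1))]]; rewrite ltrDl ltr01 => /(_ isT) H.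
by exists (M + 1) => x xab; apply: H; exists x.
Qed.

Lemma continuous_bounded_set n (D : set 'rV[R]_n) (g : 'rV[R]_n -> R) :
  continuous g -> bounded_set D -> exists C, forall x, D x -> `|g x| <= C.
Proof.
move=> cg /bounded_set_obox[M DM].
have [C HC] := continuous_bounded_cbox (const_mx (- M)) (const_mx M) cg.
exists C => x /DM xM; apply: HC => i; have := xM i.
by move=> /andP[/ltW -> /ltW ->].
Qed.

Lemma continuous_bounded_integrable n (D : set 'rV[R]_n) (g : 'rV[R]_n -> R) :
  continuous g -> measurable D -> bounded_set D ->
  (leb n).-integrable D (EFin \o g).
Proof.
move=> cg mD bD; have [C HC] := continuous_bounded_set cg bD.
apply: measurable_bounded_integrable => //; first exact: leb_bounded_lty.
  exact: continuous_measurable_rV.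
exists C; split; first exact: num_real.
by move=> M CM x Dx; apply: le_trans (ltW CM); exact: HC.
Qed.

Lemma continuous_L2 n (D : set 'rV[R]_n) (g : 'rV[R]_n -> R) :
  continuous g -> measurable D -> bounded_set D -> L2 D g.
Proof.
move=> cg mD bD; split; first exact: continuous_measurable_rV.
apply: (@continuous_bounded_integrable _ _ (fun x => g x ^+ 2)) => //.
by move=> x; apply: (@continuousM _ _ g g); exact: cg.
Qed.

End continuous_integrable.

(** * Integrals of partial derivatives of functions with bounded support *)

Section integral_of_derivative.
Context {R : realType}.
Local Notation lebT := (@lebesgue_measure R).
Local Notation e_ := (delta_mx ord0).

Lemma continuous_rV_cons_l n (u : 'rV[R]_n) :
  continuous (fun a : R => @rV_cons R n (a, u)).
Proof.
move=> a P /rV_nbhsP[e e0 eP]; apply/nbhs_ballP; exists e => //= b ab.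
apply: eP => i; case: (unliftP ord0 i) => [k|] ->.
  by rewrite !rV_cons_coordS subrr normr0.
by rewrite !rV_cons_coord0.
Qed.

Lemma continuous_rV_cons_r n (a : R) : continuous (fun u => @rV_cons R n (a, u)).
Proof.
move=> u P /rV_nbhsP[e e0 eP]; apply/rV_nbhsP; exists e => // b ab.
apply: eP => i; case: (unliftP ord0 i) => [k|] ->.
  by rewrite !rV_cons_coordS.
by rewrite !rV_cons_coord0 subrr normr0.
Qed.

Lemma rV_consD0 n (a h : R) (u : 'rV[R]_n) :
  rV_cons (a + h, u) = rV_cons (a, u) + h *: e_ ord0.
Proof.
apply/rowP => i; rewrite [RHS]mxE [X in _ = _ + X]mxE [X in _ = _ + _ * X]mxE eqxx/=.
case: (unliftP ord0 i) => [k|] ->; first by rewrite !rV_cons_coordS mulr0 addr0.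
by rewrite !rV_cons_coord0 eqxx mulr1.
Qed.

Lemma rV_consDS n (a h : R) (u : 'rV[R]_n) (k : 'I_n) :
  rV_cons (a, h *: e_ k + u) = h *: e_ (lift ord0 k) + rV_cons (a, u).
Proof.
apply/rowP => i; rewrite [RHS]mxE [X in _ = X + _]mxE [X in _ = _ * X + _]mxE eqxx/=.
case: (unliftP ord0 i) => [l|] ->.
  by rewrite !rV_cons_coordS !mxE eqxx/= (inj_eq lift_inj).
by rewrite !rV_cons_coord0 mulr0 add0r.
Qed.

Lemma C1_slice n (f : 'rV[R]_n.+1 -> R) (a : R) : C1 f ->
  C1 (fun u => f (rV_cons (a, u))) /\ forall k u,
  partial k (fun u => f (rV_cons (a, u))) u = partial (lift ord0 k) f (rV_cons (a, u)).
Proof.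
move=> Cf.
apply: (@C1_intro _ _ _ (fun k u => partial (lift ord0 k) f (rV_cons (a, u)))) => k.
  move=> u; have [d1 d2] := C1_is_derive (lift ord0 k) (rV_cons (a, u)) Cf.
  have E : (fun h : R => h^-1 *: (((fun u => f (rV_cons (a, u))) \o shift u)
        (h *: e_ k) - f (rV_cons (a, u)))) =
      (fun h => h^-1 *: ((f \o shift (rV_cons (a, u))) (h *: e_ (lift ord0 k))
         - f (rV_cons (a, u)))).
    by apply/funext => h /=; rewrite /shift rV_consDS.
  by split; [rewrite /derivable E|rewrite /derive E].
move=> u; have [_ cf] := Cf (lift ord0 k).
apply: (@continuous_comp _ _ _ (fun u => @rV_cons R n (a, u)) (partial (lift ord0 k) f)).
  exact: continuous_rV_cons_r.
exact: cf.
Qed.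

(** Bounded support is phrased through coordinates so that the slices along [rV_cons] inherit it. *)
Definition vanish_outside n (M : R) (f : 'rV[R]_n -> R) :=
  forall x : 'rV[R]_n, (exists i, M <= `|x ord0 i|) -> f x = 0.

(** The margin 1 leaves a neighbourhood of the point on which [f] vanishes identically. *)
Lemma vanish_partial n (M : R) (f : 'rV[R]_n -> R) (i : 'I_n) :
  vanish_outside M f -> vanish_outside (M + 1) (partial i f).
Proof.
move=> f0 x [j Mx].
have nf : \near x, f x = cst 0 x.
  apply/rV_nbhsP; exists 1 => // y xy; apply: f0; exists j.
  by have := ler_normB (x ord0 j - y ord0 j) (- y ord0 j); have := xy j;
    rewrite opprK subrK normrN; lra.
by rewrite /partial (near_eq_derive _ nf) derive_cst.
Qed.

Lemma vanish_integrable n (M : R) (g : 'rV[R]_n -> R) : continuous g ->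
  vanish_outside M g -> (leb n).-integrable setT (EFin \o g).
Proof.
move=> cg g0.
pose B : set 'rV[R]_n := cbox (const_mx (- `|M|)) (const_mx `|M|).
have mB : measurable B by apply: measurable_closed_rV; exact: closed_cbox.
have bB : bounded_set B by apply: compact_bounded; exact: compact_cbox.
have := continuous_bounded_integrable cg mB bB.
move/(integrable_mkcond _ mB); apply: eq_integrable => // x _.
rewrite patchE; case: ifPn => // xB; rewrite /= g0//.
apply: contrapT => H; move/negP: xB; apply; rewrite inE => i.
rewrite !mxE -ler_norml leNgt; apply/negP => Mx; apply: H; exists i.
exact: le_trans (ler_norm _) (ltW Mx).
Qed.

Lemma integral_line_derivative (F f : R -> R) (M : R) :
  continuous f -> (forall t : R, is_derive t 1 F (f t)) ->
  (forall t, M <= `|t| -> F t = 0 /\ f t = 0) ->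
  (\int[lebT]_t (f t)%:E = 0)%E.
Proof.
move=> cf Ff F0.
(* [M] may be negative; [N] is positive and still at least [M], so that [[-N, N]] is a proper
   interval with [F] zero at both ends. *)
pose N : R := `|M| + 1.
have NM : M <= N by rewrite /N; have := ler_norm M; lra.
have N0 : 0 < N by rewrite /N ltr_wpDl.
have cF : continuous F.
  by move=> t; apply/differentiable_continuous/derivable1_diffP; exact: ex_derive.
transitivity (\int[lebT]_(t in `[(- N)%R, N%R]) (f t)%:E)%E.
  rewrite [RHS]integral_mkcond; apply: eq_integral => t _; rewrite patchE.
  case: ifPn => // /negP H; rewrite (F0 t _).2//.
  rewrite leNgt; apply/negP => tM; apply: H; rewrite inE/= in_itv/= -ler_norml.
  exact: le_trans (ltW tM) NM.
rewrite (@continuous_FTC2 _ f F).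
- rewrite (F0 N _).1 ?(F0 (- N) _).1 ?subee//; rewrite ?normrN gtr0_norm//.
- by lra.
- exact: continuous_subspaceT.
- split=> [t _||]; first exact: ex_derive.
  + by apply: cvg_at_right_filter; exact: cF.
  + by apply: cvg_at_left_filter; exact: cF.
- by move=> t _; rewrite derive1E derive_val.
Qed.

(* Fubini peels off the first coordinate, where the fundamental theorem of
   calculus applies; the other coordinates are handled by induction. *)
Lemma integral_partial_eq0 n (f : 'rV[R]_n -> R) (i : 'I_n) (M : R) :
  C1 f -> vanish_outside M f -> \int[leb n]_x partial i f x = 0.
Proof.
rewrite /Rintegral => Cf f0; suff -> : (\int[leb n]_x (partial i f x)%:E = 0)%E by [].
elim: n f i Cf f0 => [f []//|n IH f i Cf f0].
have [_ ci] := Cf i.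
have ip := vanish_integrable ci (vanish_partial i f0).
have mp : measurable_fun setT (EFin \o partial i f).
  by apply/measurable_EFinP; exact: continuous_measurable_rV.
have mc := @measurable_rV_cons R n.
have ic : (lebT \x leb n)%E.-integrable setT (EFin \o partial i f \o @rV_cons R n).
  apply/integrableP; split; first exact: measurableT_comp.
  move/integrableP: ip => [_]; rewrite ge0_integral_pushforward//.
  exact: measurableT_comp.
have -> : (\int[leb n.+1]_x (partial i f x)%:E =
    \int[lebT \x leb n]_p (partial i f (rV_cons p))%:E)%E.
  by rewrite (integral_pushforward mc mp).
case: (unliftP ord0 i) => [k|] Ei.
  rewrite -(integral12_prod_meas1 ic)/= /fubini_F/=.
  rewrite integral0_eq// => a _.
  have [Ca pa] := C1_slice a Cf.
  rewrite Ei; under eq_integral do rewrite -pa.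
  by apply: IH => // u [j Mj]; apply: f0; exists (lift ord0 j); rewrite rV_cons_coordS.
rewrite -(integral21_prod_meas1 ic)/= /fubini_G/=.
rewrite integral0_eq// => u _.
have H t : M + 1 <= `|t| -> f (rV_cons (t, u)) = 0 /\ partial i f (rV_cons (t, u)) = 0.
  move=> Mt; split; first by apply: f0; exists ord0; rewrite rV_cons_coord0; lra.
  by apply: (vanish_partial _ f0); exists ord0; rewrite rV_cons_coord0.
apply: (integral_line_derivative (F := fun t => f (rV_cons (t, u))) (M := M + 1)) => //.
  move=> t; apply: (@continuous_comp _ _ _ (fun a => @rV_cons R n (a, u)) (partial i f)).
    exact: continuous_rV_cons_l.
  exact: ci.
move=> t; have E s : rV_cons (s, u) = rV_cons (0, u) + s *: e_ ord0.
  by rewrite -rV_consD0 add0r.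
rewrite (_ : (fun t => f _) = fun s => f (rV_cons (0, u) + s *: e_ i)); last first.
  by apply/funext => s; rewrite E Ei.
by apply: is_derive_line; rewrite Ei -E -Ei; exact: C1_is_derive.
Qed.

End integral_of_derivative.

(** * Test functions *)

Section test_functions.
Context {R : realType} {n : nat}.
Implicit Types (D U : set 'rV[R]_n) (f g phi psi : 'rV[R]_n -> R) (u v : h1fun R n).

Lemma test_fun_out D psi x : test_fun D psi -> ~ D x ->
  psi x = 0 /\ forall i, partial i psi x = 0.
Proof.
move=> [_ _ sD] Dx.
have [/sD//|] := pselect (closure [set y | psi y != 0] x).
move=> ncx; have z0 y : (~` closure [set y | psi y != 0]) y -> psi y = 0.
  by move=> H; apply/eqP/negPn/negP => py; apply: H; exact: subset_closure.
split=> [|i]; first exact: z0.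
have nf : \near x, psi x = cst 0 x.
  near=> y; apply: z0; near: y; apply: open_nbhs_nbhs; split=> //.
  by apply: closed_openC; exact: closed_closure.
by rewrite /partial (near_eq_derive _ nf) derive_cst.
Unshelve. all: by end_near. Qed.

Lemma test_fun_vanish D psi : test_fun D psi -> exists M, vanish_outside M psi.
Proof.
move=> [_ cs _]; have /bounded_set_obox[M HM] := compact_bounded cs.
exists M => x [i Mx]; apply/eqP/negPn/negP => px.
have /HM/(_ i) : closure [set x | psi x != 0] x by exact: subset_closure.
by rewrite !mxE -ltr_norml ltNge Mx.
Qed.

(** Integration by parts: [phi] need not vanish anywhere, but its product with a test function has
    bounded support, so the partial derivatives of the product integrate to 0 over the whole
    space. *)
Lemma H1_C1 D phi : open D -> bounded_set D -> C1 phi -> H1 D (phi, grad phi).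
Proof.
move=> oD bD Cp; have mD := measurable_open_rV oD.
have cp := C1_continuous Cp.
have gE x i : grad phi x ord0 i = partial i phi x by rewrite mxE.
split=> /= [|i|psi tpsi i]; first exact: continuous_L2.
  by under eq_fun do rewrite gE; apply: continuous_L2 => //; have [] := Cp i.
have [Cpsi _ _] := tpsi; have cpsi := C1_continuous Cpsi.
have [_ cpi] := Cp i; have [_ cpsii] := Cpsi i.
have [Cf fE] := C1M Cp Cpsi.
have [M psiM] := test_fun_vanish tpsi.
have fM : vanish_outside M (fun x => phi x * psi x).
  by move=> x xM; rewrite psiM// mulr0.
have := integral_partial_eq0 i Cf fM.
have -> : \int[leb n]_x partial i (fun x => phi x * psi x) x =
    \int[leb n]_(x in D) (phi x * partial i psi x + psi x * partial i phi x).
  rewrite [RHS]Rintegral_mkcond; apply: eq_Rintegral => x _.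
  rewrite fE patchE; case: ifPn => //; rewrite notin_setE => Dx.
  by have [-> ->] := test_fun_out tpsi Dx; rewrite mulr0 mul0r addr0.
rewrite RintegralD//; first last.
- apply: continuous_bounded_integrable => // x.
  by apply: (@continuousM _ _ psi (partial i phi)); [exact: cpsi|exact: cpi].
- apply: continuous_bounded_integrable => // x.
  by apply: (@continuousM _ _ phi (partial i psi)); [exact: cp|exact: cpsii].
move/eqP; rewrite addr_eq0 => /eqP ->; congr (- _).
by apply: eq_Rintegral => x _; rewrite gE mulrC.
Qed.

Lemma grad_cst (a : R) : grad (cst a : 'rV[R]_n -> R) = cst 0.
Proof. by apply/funext => x; apply/rowP => i; rewrite !mxE (C1_cst a).2. Qed.

Lemma H1_cst D (a : R) : open D -> bounded_set D -> H1 D (cst a, cst 0).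
Proof. by move=> oD bD; rewrite -(grad_cst a); apply: H1_C1 => //; exact: (C1_cst a).1. Qed.

Lemma test_fun_sqint D U psi : measurable U -> bounded_set U -> test_fun D psi ->
  L2 U psi /\ forall i, L2 U (partial i psi).
Proof.
move=> mU bU [Cpsi _ _]; split=> [|i].
  by apply: continuous_L2 => //; exact: C1_continuous.
by apply: continuous_L2 => //; have [] := Cpsi i.
Qed.

Lemma H1_lin D (a : R) u v : measurable D -> bounded_set D ->
  H1 D u -> H1 D v -> H1 D (h1_lin a u v).
Proof.
move=> mD bD [u1 u2 u3] [v1 v2 v3]; split=> /=.
- by apply: sqintD => //; exact: sqintZ.
- move=> i; under eq_fun do rewrite !mxE.
  by apply: sqintD => //; [apply: sqintZ => //; exact: u2|exact: v2].
- move=> psi tpsi i; have [p1 p2] := test_fun_sqint mD bD tpsi.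
  have iu : (leb n).-integrable D (EFin \o (fun x => u.1 x * partial i psi x)).
    exact: (sqint_prod mD u1 (p2 i)).
  have iv : (leb n).-integrable D (EFin \o (fun x => v.1 x * partial i psi x)).
    exact: (sqint_prod mD v1 (p2 i)).
  have ju : (leb n).-integrable D (EFin \o (fun x => u.2 x ord0 i * psi x)).
    exact: (sqint_prod mD (u2 i) p1).
  have jv : (leb n).-integrable D (EFin \o (fun x => v.2 x ord0 i * psi x)).
    exact: (sqint_prod mD (v2 i) p1).
  transitivity (a * \int[leb n]_(x in D) (u.1 x * partial i psi x) +
      \int[leb n]_(x in D) (v.1 x * partial i psi x)).
    rewrite -RintegralZl// -RintegralD//; last exact: integrableZl_EFin.
    by apply: eq_Rintegral => x _; ring.
  rewrite u3// v3// mulrN -opprD; congr (- _).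
  rewrite -RintegralZl// -RintegralD//; last exact: integrableZl_EFin.
  by apply: eq_Rintegral => x _; rewrite !mxE; ring.
Qed.

End test_functions.

(** * Bump functions and a monotone class theorem *)

Section monotone_class.
Context {R : realType} {n : nat}.
Implicit Types (a b x : 'rV[R]_n) (f g phi chi : 'rV[R]_n -> R) (U E : set 'rV[R]_n).

Definition unit_range f := forall x, 0 <= f x <= 1.

Definition unit_C1 f := C1 f /\ unit_range f.

(** The product of the squared positive parts of [x_i - s] and [t - x_i]. The factor in front keeps
    the values below 1; its [+ 1] avoids a division by zero when [s = t]. *)
Definition bump1 (i : 'I_n) (s t : R) x : R :=
  ((t - s) ^+ 4 + 1)^-1 * (pos2 (1 * x ord0 i - s) * pos2 (- 1 * x ord0 i - (- t))).

Lemma bump1_unit i s t : unit_C1 (bump1 i s t).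
Proof.
split=> [|x].
  apply: (C1M (C1_cst _).1 _).1; apply: (C1M _ _).1; exact: pos2_C1.
have k0 : 0 < (t - s) ^+ 4 + 1 by rewrite ltr_wpDl// exprn_even_ge0.
rewrite /bump1 mulr_ge0 ?invr_ge0 ?(ltW k0)//=; last by rewrite mulr_ge0// sqr_ge0.
rewrite mulrC ler_pdivrMr// mul1r mul1r mulN1r opprK /pos2 -exprMn.
set y := x ord0 i.
have [ys|sy] := leP y s.
  rewrite (_ : Num.max (y - s) 0 = 0); last by apply/max_idPr; lra.
  by rewrite mul0r expr0n ltW.
have [ty|yt] := leP t y.
  rewrite (_ : Num.max (- y + t) 0 = 0); last by apply/max_idPr; lra.
  by rewrite mulr0 expr0n ltW.
rewrite (_ : Num.max (y - s) 0 = y - s); last by apply/max_idPl; lra.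
rewrite (_ : Num.max (- y + t) 0 = t - y); last first.
  by rewrite addrC; apply/max_idPl; lra.
apply: (@le_trans _ _ ((t - s) ^+ 4)); last by rewrite lerDl.
rewrite (_ : (t - s) ^+ 4 = ((t - s) ^+ 2) ^+ 2); last by rewrite -exprM.
by rewrite lerXn2r ?nnegrE ?mulr_ge0 ?sqr_ge0//; nra.
Qed.

Lemma bump1_neq0 i s t x : (bump1 i s t x != 0) = (s < x ord0 i < t).
Proof.
have k0 : 0 < (t - s) ^+ 4 + 1 by rewrite ltr_wpDl// exprn_even_ge0.
have E (z : R) : (pos2 z != 0) = (0 < z).
  rewrite /pos2 expf_eq0/= /Num.max.
  by case: ltgtP => [||->]; rewrite ?eqxx// => z0; rewrite gt_eqF.
rewrite /bump1 mul1r mulN1r opprK mulf_eq0 invr_eq0 (gt_eqF k0)/= mulf_eq0 negb_or !E.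
by rewrite subr_gt0 addrC subr_gt0.
Qed.

Lemma unit_C1_prod I (s : seq I) (F : I -> 'rV[R]_n -> R) :
  (forall i, unit_C1 (F i)) -> unit_C1 (fun x => \prod_(i <- s) F i x).
Proof.
move=> HF; split=> [|x]; first by apply: C1_prod => i; have [] := HF i.
elim/big_ind : _ => [|y z /andP[y0 y1] /andP[z0 z1]|i _]; first by rewrite ler01 lexx.
  by rewrite mulr_ge0//= mulr_ile1.
by have [_ /(_ x)] := HF i.
Qed.

Definition bump a b x : R := \prod_i bump1 i (a ord0 i) (b ord0 i) x.

Lemma bump_neq0 a b : [set x | bump a b x != 0] = obox a b.
Proof.
apply/seteqP; split=> x /=; rewrite /bump.
  by move=> /prodf_neq0 H i; rewrite -bump1_neq0 H.
by move=> H; apply/prodf_neq0 => i _; rewrite bump1_neq0.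
Qed.

Lemma bump_unit a b : unit_C1 (bump a b).
Proof. by apply: unit_C1_prod => i; exact: bump1_unit. Qed.

Lemma bump_test a b U : cbox a b `<=` U -> test_fun U (bump a b).
Proof.
move=> abU; have [Cb _] := bump_unit a b.
have sb : closure [set x | bump a b x != 0] `<=` cbox a b.
  have /closure_id -> := @closed_cbox R n a b.
  by apply: closureS; rewrite bump_neq0; exact: obox_cbox.
split=> //; last exact: subset_trans abU.
by apply: subclosed_compact sb; [exact: closed_closure|exact: compact_cbox].
Qed.

(** Provides a generator of the Borel sets that is stable under intersection, by multiplying the
    functions, as Dynkin induction requires. *)
Lemma measurable_rV_unit_C1 :
  @measurable _ 'rV[R]_n = <<s [set [set x | f x != 0] | f in unit_C1] >>.
Proof.
apply/seteqP; split.
  apply: smallest_sub; first exact: smallest_sigma_algebra.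
  rewrite -bigcup_seq; apply: bigcup_sub => i _.
  move=> _ [B mB <-].
  have H : measurable_fun [set: g_sigma_algebraType
      [set [set x | f x != 0] | f in @unit_C1]] (rV_coord (i)).
    apply: (measurability _ (measurable_realfun.RGenOpens.measurableE R)).
    move=> _ [_ [s [t ->] <-]]; rewrite setTI; apply: sub_sigma_algebra.
    exists (bump1 (i) s t); first exact: bump1_unit.
    by apply/seteqP; split=> x /=; rewrite bump1_neq0 in_itv.
  exact: H.
apply: smallest_sub; first exact: sigma_algebra_measurable.
move=> _ [f [Cf _] <-]; apply: measurable_open_rV.
have -> : [set x | f x != 0] = f @^-1` [set y | y != 0] by [].
by apply: open_comp => [x _|]; [exact: C1_continuous|exact: open_neq].
Qed.

End monotone_class.

Section monotone_class_theorem.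
Context {R : realType} {n : nat}.
Implicit Types (f g phi chi : 'rV[R]_n -> R) (U E : set 'rV[R]_n).

Definition unit_meas f := measurable_fun setT f /\ unit_range f.

Lemma unit_C1_meas f : unit_C1 f -> unit_meas f.
Proof.
by move=> [Cf uf]; split=> //; apply: continuous_measurable_rV => //; exact: C1_continuous.
Qed.

Lemma unit_meas_indic E : measurable E -> unit_meas (\1_E).
Proof.
move=> mE; split=> [|x]; first exact: measurable_indic.
by rewrite indicE; case: (_ \in _); rewrite ?ler01 ?lexx.
Qed.

(** Exactly what Dynkin induction asks of a property of functions: differences for complements, sums
    for finite disjoint unions, pointwise limits for countable ones. *)
Definition unit_closed (Z : ('rV[R]_n -> R) -> Prop) :=
  [/\ forall f g, unit_meas f -> unit_meas g -> Z f -> Z g -> Z (fun x => f x - g x),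
      forall f g, unit_meas f -> unit_meas g -> Z f -> Z g -> Z (fun x => f x + g x) &
      forall (f_ : nat -> 'rV[R]_n -> R) f, (forall k, unit_meas (f_ k)) ->
        (forall x, f_ k x @[k --> \oo] --> f x) -> (forall k, Z (f_ k)) -> Z f].

Lemma cvg_indicator (a : R) : 0 <= a <= 1 ->
  1 - (1 - a) ^+ k @[k --> \oo] --> ((a != 0)%:R : R).
Proof.
move=> /andP[a0 a1]; have [->|an0] := eqVneq a 0.
  by rewrite subr0; under eq_cvg do rewrite expr1n subrr; exact: cvg_cst.
rewrite -[X in _ --> X]subr0; apply: cvgB; first exact: cvg_cst.
apply: cvg_expr; rewrite ger0_norm ?subr_ge0//.
by rewrite ltrBlDr ltrDl lt_def an0.
Qed.

(* With [S = {chi <> 0}] and [f] a C^1 function with values in [0, 1], the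
   functions [1 - (1 - f chi)^k] are test functions increasing to the
   indicator of [S] intersected with [{f <> 0}]. *)
Lemma test_monotone_class U (Z : ('rV[R]_n -> R) -> Prop) chi : unit_closed Z ->
  (forall phi, test_fun U phi -> unit_range phi -> Z phi) ->
  test_fun U chi -> unit_range chi ->
  forall E, measurable E -> Z (\1_(E `&` [set x | chi x != 0])).
Proof.
move=> [Zsub Zadd Zlim] Ztest tchi uchi; have [Cchi cchi schi] := tchi.
set S := [set x | chi x != 0].
have mS : measurable S.
  apply: measurable_open_rV; apply: (@open_comp _ _ chi [set y | y != 0]) => [x _|].
    exact: C1_continuous.
  exact: open_neq.
have ZG f : unit_C1 f -> Z (\1_([set x | f x != 0] `&` S)).
  move=> [Cf uf].
  pose f_ (k : nat) x := 1 - (1 - f x * chi x) ^+ k.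
  have fc x : 0 <= f x * chi x <= 1.
    have /andP[? ?] := uf x; have /andP[? ?] := uchi x.
    by rewrite mulr_ge0//= mulr_ile1.
  have uf_ k : unit_range (f_ k).
    move=> x; have /andP[? ?] := fc x; rewrite /f_.
    by rewrite subr_ge0 exprn_ile1 ?subr_ge0//= ?gerBl ?exprn_ge0 ?subr_ge0//; lra.
  have Cf_ k : C1 (f_ k).
    apply: (C1B (C1_cst 1).1 _).1; apply: C1X.
    by apply: (C1B (C1_cst 1).1 _).1; exact: (C1M Cf Cchi).1.
  apply: (Zlim f_) => [k|x|k].
  - exact: unit_C1_meas.
  - have -> : \1_([set x | f x != 0] `&` S) x = (f x * chi x != 0)%:R :> R.
      rewrite indicE; suff -> : (x \in [set x | f x != 0] `&` S) = (f x * chi x != 0) by [].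
      apply/idP/idP; first by rewrite inE => -[? ?]; rewrite mulf_neq0.
      by rewrite mulf_eq0 negb_or => /andP[? ?]; rewrite inE.
    exact: cvg_indicator.
  - apply: Ztest => //.
    have sub : closure [set x | f_ k x != 0] `<=` closure [set x | chi x != 0].
      apply: closureS => x /=; apply: contraNN => /eqP cx.
      by rewrite /f_ cx mulr0 subr0 expr1n subrr.
    split=> //; last exact: subset_trans schi.
    by apply: subclosed_compact sub => //; exact: closed_closure.
have ZT : Z (\1_S).
  have -> : S = [set x | cst 1 x != 0 :> R] `&` S.
    by apply/seteqP; split=> x /=; [move=> ?; split=> //; exact: oner_neq0|case].
  apply: (ZG (cst 1)); split=> [|x]; first exact: (C1_cst 1).1.
  by rewrite /= ler01 lexx.
have uS := unit_meas_indic mS.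
move=> E mE.
pose P (A : set 'rV[R]_n) := Z (\1_(A `&` S)).
have := @dynkin_induction _ 'rV[R]_n _ P measurable_rV_unit_C1; rewrite {1}/P.
move=> H; apply: (H _ _ _ _ _ E); rewrite {H}.
- move=> _ _ [f [Cf uf] <-] [g [Cg ug] <-]; exists (fun x => f x * g x).
    split=> [|x]; first exact: (C1M Cf Cg).1.
    have /andP[? ?] := uf x; have /andP[? ?] := ug x.
    by rewrite mulr_ge0//= mulr_ile1.
  apply/seteqP; split=> x /=; first by rewrite mulf_eq0 negb_or => /andP[].
  by move=> [? ?]; rewrite mulf_neq0.
- by rewrite setTI.
- by move=> _ [f uf <-]; exact: ZG.
- move=> A mA PA; rewrite /P.
  have -> : \1_(~` A `&` S) = (fun x => \1_S x - \1_(A `&` S) x : R).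
    apply/funext => x; rewrite !indicE !in_setI in_setC.
    by case: (x \in A); case: (x \in S); rewrite /= ?subr0 ?subrr.
  by apply: Zsub => //; apply: unit_meas_indic; exact: measurableI.
- move=> F mF tF PF; rewrite /P.
  pose f_ (k : nat) x := \sum_(i < k) \1_(F i `&` S) x : R.
  have fE k : f_ k = \1_(\big[setU/set0]_(i < k) F i `&` S).
    apply/funext => x; rewrite /f_; elim: k => [|k IH].
      by rewrite !big_ord0 set0I indicE in_set0.
    rewrite !big_ord_recr/= IH !indicE !in_setI in_setU.
    have [xk|] := boolP (x \in F k); last by rewrite /= addr0 orbF.
    have -> : (x \in \big[setU/set0]_(i < k) F i) = false.
      apply/negP; rewrite inE -bigcup_mkord => -[i /= ik Fi].
      move/trivIsetP : tF => /(_ i k Logic.I Logic.I); rewrite ltn_eqF// => /(_ isT).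
      by move/seteqP => [/(_ x) + _]; apply; split=> //; rewrite inE in xk.
    by rewrite add0r.
  have mFk k : measurable (\big[setU/set0]_(i < k) F i).
    by apply: bigsetU_measurable => i _; exact: mF.
  have uf_ k : unit_meas (f_ k).
    by rewrite fE; apply: unit_meas_indic; exact: measurableI.
  apply: (Zlim f_) => // [x|k].
    apply: cvg_near_cst; have [xF|xF] := boolP (x \in (\bigcup_k F k) `&` S).
      move: (xF); rewrite inE => -[[i _ Fi] Sx].
      exists i.+1 => // k /= ik; rewrite fE !indicE xF.
      rewrite mem_set//; split=> //; rewrite -bigcup_mkord; exists i => //=.
    near=> k; rewrite fE !indicE (negbTE xF) (_ : _ \in _ = false)//.
    apply/negbTE; apply: contra xF; rewrite !inE => -[+ Sx].
    by rewrite -bigcup_mkord => -[i _ Fi]; split=> //; exists i.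
  elim: k => [|k IH].
    rewrite (_ : f_ 0%N = fun x => \1_S x - \1_S x); first exact: Zsub.
    by apply/funext => x; rewrite /f_ big_ord0 subrr.
  rewrite (_ : f_ k.+1 = fun x => f_ k x + \1_(F k `&` S) x); last first.
    by apply/funext => x; rewrite /f_ big_ord_recr.
  apply: Zadd => //; last exact: PF.
  by apply: unit_meas_indic; exact: measurableI.
- by rewrite -measurable_rV_unit_C1.
Unshelve. all: by end_near. Qed.

(** A finite sum of integrals of pullbacks covers both uses: one integral over a domain, with [p]
    the identity, and a sum over all subfaces, with [p] the parametrizations of their faces. The
    limit clause is dominated convergence, the range [0, 1] giving the bound [|g|]. *)
Lemma unit_closed_integral d (T : measurableType d) (mu : {measure set T -> \bar R})
    (I : Type) (s : seq I) (D : I -> set T) (p : I -> T -> 'rV[R]_n) (g : I -> T -> R) :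
  (forall i, measurable (D i)) -> (forall i, measurable_fun setT (p i)) ->
  (forall i, mu.-integrable (D i) (EFin \o g i)) ->
  unit_closed (fun f => \sum_(i <- s) \int[mu]_(x in D i) (g i x * f (p i x)) = 0).
Proof.
move=> mD mp ig.
have mpi f i : unit_meas f -> measurable_fun (D i) (f \o p i).
  move=> [mf _]; apply: (@measurable_funS _ _ _ _ setT) => //.
  exact: measurableT_comp.
have igf f i : unit_meas f -> mu.-integrable (D i) (EFin \o (fun x => g i x * f (p i x))).
  move=> uf; have /integrableP[mgi _] := ig i.
  apply: (le_integrable (mD i) _ _ (ig i)).
    apply/measurable_EFinP; apply: measurable_funM; first exact/measurable_EFinP.
    exact: mpi.
  move=> x _ /=; rewrite lee_fin normrM ler_piMr//.
  by have /andP[? ?] := uf.2 (p i x); rewrite ger0_norm.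
split.
- move=> f f' uf uf' Zf Zf'.
  under eq_bigr do under eq_Rintegral do rewrite mulrBr.
  rewrite (eq_bigr (fun i => \int[mu]_(x in D i) (g i x * f (p i x)) -
    \int[mu]_(x in D i) (g i x * f' (p i x)))).
    by rewrite sumrB Zf Zf' subrr.
  by move=> i _; rewrite RintegralB//; exact: igf.
- move=> f f' uf uf' Zf Zf'.
  under eq_bigr do under eq_Rintegral do rewrite mulrDr.
  rewrite (eq_bigr (fun i => \int[mu]_(x in D i) (g i x * f (p i x)) +
    \int[mu]_(x in D i) (g i x * f' (p i x)))).
    by rewrite big_split/= Zf Zf' addr0.
  by move=> i _; rewrite RintegralD//; exact: igf.
- move=> f_ f uf_ f_f Zf_.
  have mf : measurable_fun setT f.
    by apply: (measurable_fun_cvg (h := f_)) => // k; have [] := uf_ k.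
  have uf : unit_meas f.
    split=> // x; apply/andP; split.
      apply: (cvgr_to_ge (f_f x)); last by near=> k; have [_ /(_ x)/andP[]] := uf_ k.
    by apply: (cvgr_to_le (f_f x)); near=> k; have [_ /(_ x)/andP[]] := uf_ k.
  have cv i : \int[mu]_(x in D i) (g i x * f_ k (p i x)) @[k --> \oo] -->
      \int[mu]_(x in D i) (g i x * f (p i x)).
    have [] := @dominated_convergence _ _ _ mu (D i) (mD i)
      (fun k x => (g i x * f_ k (p i x))%:E) (fun x => (g i x * f (p i x))%:E)
      (fun x => `|(g i x)%:E|%E).
    - by move=> k; exact: measurable_int (igf _ i (uf_ k)).
    - exact: measurable_int (igf _ i uf).
    - apply/nearW => x _; apply: cvg_EFin; first exact/nearW.
      by apply: cvgM; [exact: cvg_cst|exact: f_f].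
    - exact: integrable_abse.
    - apply/nearW => x k _; rewrite /= lee_fin normrM ler_piMr//.
      by have /andP[? ?] := (uf_ k).2 (p i x); rewrite ger0_norm.
    - move=> _ _ H; apply: fine_cvg; rewrite fineK//.
      exact/integrable_fin_num/igf.
  have cs : \sum_(i <- s) \int[mu]_(x in D i) (g i x * f_ k (p i x)) @[k --> \oo] -->
      \sum_(i <- s) \int[mu]_(x in D i) (g i x * f (p i x)).
    apply: (@cvg_big R I +%R 0 xpredT _ _ _ s) => [z|i _]; last exact: cv.
    by apply: cvgD; [exact: cvg_fst|exact: cvg_snd].
  apply: (cvg_unique _ cs) => //; apply: cvg_near_cst.
  by apply/nearW => k; exact: Zf_.
Unshelve. all: by end_near. Qed.

End monotone_class_theorem.

(** * The fundamental lemma of the calculus of variations *)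

Section fundamental_lemma.
Context {R : realType} {n : nat}.
Implicit Types (D : set 'rV[R]_n) (g : 'rV[R]_n -> R).

(** Countably many rational boxes cover [D], so their exceptional sets form one null set; [pickle]
    numbers the boxes. *)
Lemma ae_rat_boxes D (P : 'rV[R]_n -> Prop) : open D ->
  (forall p : 'rV[rat]_n * 'rV[rat]_n,
     cbox (map_mx ratr p.1) (map_mx ratr p.2) `<=` D ->
     {ae leb n, forall x, obox (map_mx ratr p.1) (map_mx ratr p.2) x -> P x}) ->
  {ae leb n, forall x, D x -> P x}.
Proof.
move=> oD HP.
have : {ae leb n, forall x (k : nat), forall p, unpickle k = Some p ->
    cbox (map_mx ratr p.1) (map_mx ratr p.2) `<=` D ->
    obox (map_mx ratr p.1) (map_mx ratr p.2) x -> P x}.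
  apply/ae_foralln => k; case E : (unpickle k) => [p|]; last exact/nearW.
  have [pD|pD] := pselect (cbox (map_mx ratr p.1) (map_mx ratr p.2) `<=` D).
    by apply: filterS (HP p pD) => x H q [<-].
  by apply/nearW => x q [<-].
apply: filterS => x H Dx; have [p [px pD]] := open_rat_box oD Dx.
by apply: (H (pickle p) p) => //; rewrite pickleK.
Qed.

(** On each box whose closure lies in [D], the monotone class theorem passes from test functions to
    indicators of Borel subsets of the box; a function whose integrals over all of these vanish is
    zero almost everywhere there. *)
Lemma test_fun_ae0 D g : open D -> bounded_set D -> (leb n).-integrable D (EFin \o g) ->
  (forall phi, test_fun D phi -> \int[leb n]_(x in D) (g x * phi x) = 0) ->
  {ae leb n, forall x, D x -> g x = 0}.
Proof.
move=> oD bD ig Hg; have mD := measurable_open_rV oD.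
apply: ae_rat_boxes => // p pD.
set a := map_mx _ p.1; set b := map_mx _ p.2.
have mS : measurable (obox a b) by exact: measurable_obox.
have SD : obox a b `<=` D by apply: subset_trans pD; exact: obox_cbox.
have igS : (leb n).-integrable (obox a b) (EFin \o g).
  exact: (integrableS mD mS SD ig).
have [_ ub] := bump_unit a b.
have uc := @unit_closed_integral R n _ _ (leb n) unit [:: tt] (fun=> D)
  (fun=> id) (fun=> g) (fun=> mD) (fun=> @measurable_id _ _ setT) (fun=> ig).
have H0 := test_monotone_class uc _ (bump_test pD) ub.
have {H0} : forall E, measurable E -> \int[leb n]_(x in D) (g x * \1_(E `&` obox a b) x) = 0.
  move=> E mE; have := H0 _ E mE; rewrite big_seq1 bump_neq0; apply.
  by move=> phi tphi _; rewrite big_seq1; exact: Hg.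
move=> H0.
have : ae_eq (leb n) (obox a b) (EFin \o g) (cst 0%E).
  apply: integral_ae_eq => //.
  move=> E ES mE; rewrite integral0.
  have iE : (leb n).-integrable E (EFin \o g) by exact: (integrableS mS mE ES igS).
  have := H0 E mE; rewrite (setIidl ES).
  have -> : \int[leb n]_(x in D) (g x * \1_E x) = \int[leb n]_(x in E) g x.
    rewrite -{2}(setIidr (subset_trans ES SD)) Rintegral_mkcondr.
    apply: eq_Rintegral => x _; rewrite indicE patchE.
    by case: ifP; rewrite ?mulr1 ?mulr0.
  rewrite /Rintegral => H1; rewrite -[LHS]fineK ?H1//.
  exact: integrable_fin_num.
by apply: filterS => x H Sx; have := H Sx; rewrite /= => -[].
Qed.

(* The gradient component of an [h1fun] is only determined through test
   functions, hence needs the fundamental lemma. *)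
Lemma H1_zero_grad D (w : h1fun R n) : open D -> bounded_set D -> H1 D w ->
  {ae leb n, forall x, D x -> w.1 x = 0} ->
  forall i, {ae leb n, forall x, D x -> w.2 x ord0 i = 0}.
Proof.
move=> oD bD [w1 w2 w3] w0 i; have mD := measurable_open_rV oD.
have fD := leb_bounded_lty mD bD.
apply: test_fun_ae0 => //; first exact: (sqint_integrable mD fD (w2 i)).
move=> phi tphi; have [Cphi _ _] := tphi.
apply/eqP; rewrite -oppr_eq0 -w3//; apply/eqP.
transitivity (\int[leb n]_(x in D) cst 0 x); last by rewrite Rintegral_cst// mul0r.
have mp : measurable_fun D (partial i phi).
  by apply: continuous_measurable_rV => //; have [] := Cphi i.
apply: Rintegral_ae_eq => //; first by apply: measurable_funM => //; have [] := w1.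
by apply: filterS w0 => x H Dx; rewrite H// mul0r.
Qed.

Lemma H1_zero_sqnorm D (w : h1fun R n) : open D -> bounded_set D -> H1 D w ->
  {ae leb n, forall x, D x -> w.1 x = 0} -> H1sqnorm D w = 0.
Proof.
move=> oD bD Hw w0; have mD := measurable_open_rV oD; have [w1 w2 _] := Hw.
have m1 : measurable_fun D w.1 by have [] := w1.
have E0 : \int[leb n]_(x in D) cst 0 x = 0 by rewrite Rintegral_cst// mul0r.
rewrite /H1sqnorm (_ : \int[leb n]_(x in D) (w.1 x ^+ 2) = 0); last first.
  rewrite -[RHS]E0; apply: Rintegral_ae_eq => //; first exact: measurable_funX.
  by apply: filterS w0 => x H Dx; rewrite H// expr0n.
rewrite add0r; under eq_Rintegral do rewrite /dot.
have i2 i : (leb n).-integrable D (EFin \o (fun x => w.2 x ord0 i * w.2 x ord0 i)).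
  by apply: sqint_prod => //; exact: w2.
rewrite Rintegral_sum// big1// => i _; rewrite -[RHS]E0.
have mi : measurable_fun D (fun x => w.2 x ord0 i) by have [] := w2 i.
apply: Rintegral_ae_eq => //; first exact: measurable_funM.
by apply: filterS (H1_zero_grad oD bD Hw w0 i) => x H Dx; rewrite H// mul0r.
Qed.

End fundamental_lemma.

(** * Meshes, traces and the solution operator *)

Section mesh_facts.
Context {R : realType} {d : nat} (Omega : set 'rV[R]_d) (M : mesh R d)
  (H h gamma : R) (Nf : nat) (hOmega : polyhedral_domain Omega)
  (hM : is_mesh M Omega H h gamma Nf).
Implicit Types (t : elt M) (F : face M) (e : subface M).

Lemma polyhedral_facts n (D : set 'rV[R]_n) : polyhedral_domain D ->
  [/\ open D, bounded_set D, measurable D, (leb n D < +oo)%E & 0 < fine (leb n D)].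
Proof.
move=> [[D0 oD _ bD] _]; have mD := measurable_open_rV oD.
have fD := leb_bounded_lty mD bD; split=> //.
by rewrite fine_gt0// leb_open_gt0.
Qed.

Lemma cell_poly t : polyhedral_domain (cell t).
Proof. by have [/(_ t)[]] := hM. Qed.

Lemma cell_sub t : cell t `<=` Omega.
Proof. by have [/(_ t)[]] := hM. Qed.

Lemma cell_disj t t' : t != t' -> cell t `&` cell t' = set0.
Proof. by have [_ [+ _] _ _ _] := hM; apply. Qed.

Lemma fdom_poly F : polyhedral_domain (fdom F).
Proof. by have [_ _ [/(_ F)[]]] := hM. Qed.

Lemma sdom_poly e : polyhedral_domain (sdom e).
Proof. by have [_ _ _ _ [/(_ e)[]]] := hM. Qed.

Lemma sdom_sub e : sdom e `<=` fdom (par e).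
Proof. by have [_ _ _ _ [/(_ e)[]]] := hM. Qed.

Lemma face_mapK F z : (face_map F z - forg F) *m (ffrm F)^T = z.
Proof.
have [_ _ [/(_ F)[FF _] _ _ _] _ _] := hM.
by rewrite /face_map addrC addKr -mulmxA FF mulmx1.
Qed.

Lemma face_sub_bdry t F : F \in faces t -> face_set F `<=` bdry (cell t).
Proof. by rewrite finset.inE => /asboolP. Qed.

Lemma mem_elts t F : (t \in elts F) = (F \in faces t).
Proof. by rewrite finset.inE. Qed.

Lemma interior_face t t' F : t != t' -> F \in faces t -> F \in faces t' ->
  elts F = [set t; t']%SET /\ face_set F `<=` Omega.
Proof.
move=> tt' Ft Ft'; have sub : ([set t; t'] \subset elts F)%SET.
  by apply/fintype.subsetP => s; rewrite mem_elts in_set2 => /orP[] /eqP ->.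
have c2 : #|[set t; t']%SET| = 2%N by rewrite cards2 tt'.
have [_ _ [_ _ _ /(_ F)[[c1 _]|[c FO]]] _ _] := hM.
  by have := subset_leq_card sub; rewrite c1 c2.
by split=> //; apply/esym/eqP; rewrite eqEcard sub c c2.
Qed.

Lemma mem_patches (K : elt M) j t : (t \in patches K j.+2) =
  [exists t', (t' \in patches K j.+1) &&
     `[< closure (cell t) `&` closure (cell t') !=set0 >]].
Proof. by rewrite finset.inE. Qed.

(** Patches grow by contact of closures, and a common face is such a contact, since its points lie
    on both boundaries. *)
Lemma patch_neighbour t t' F K j : (0 < j)%N -> t' \in patches K j ->
  F \in faces t -> F \in faces t' -> t \in patches K j.+1.
Proof.
case: j => // j _ t'K Ft Ft'.
rewrite mem_patches; apply/existsP; exists t'; rewrite t'K/=.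
apply/asboolP; have [[[z Fz] _ _ _] _] := fdom_poly F.
have Fx : face_set F (face_map F z) by exists z.
exists (face_map F z); split.
  by have [] := face_sub_bdry Ft Fx.
by have [] := face_sub_bdry Ft' Fx.
Qed.

Lemma patches_sub (K : elt M) j : patches K j \subset patches K j.+1.
Proof.
case: j => [|j]; first exact: finset.sub0set.
apply/fintype.subsetP => t tK; rewrite mem_patches.
apply/existsP; exists t; rewrite tK/=; apply/asboolP.
have [[[x tx] _ _ _] _] := cell_poly t.
by exists x; split; exact: subset_closure.
Qed.

Lemma center_in_patches (K : elt M) j : (0 < j)%N -> K \in patches K j.
Proof.
elim: j => // -[_ _|j IH _]; first by rewrite /= finset.inE.
by move/fintype.subsetP : (patches_sub K j.+1); apply; exact: IH.
Qed.

Lemma bdry_null n (D : set 'rV[R]_n) : polyhedral_domain D ->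
  exists N, [/\ measurable N, leb n N = 0%E & bdry D `<=` N].
Proof.
move=> [_ [_ [s [s0 sD]]]].
exists (\big[setU/set0]_(p <- s) hyperplane p); split.
- by apply: bigsetU_measurable => p _; exact: measurable_hyperplane.
- elim: s s0 {sD} => [|p s IH] s0; first by rewrite big_nil measure0.
  rewrite big_cons null_set_setU//.
  + exact: measurable_hyperplane.
  + by apply: bigsetU_measurable => q _; exact: measurable_hyperplane.
  + by apply: leb_hyperplane; apply: s0; rewrite mem_head.
  + by apply: IH => q qs; apply: s0; rewrite in_cons qs orbT.
- by rewrite -bigcup_seq.
Qed.

(** Only the closures of the cells are given to cover [Omega]; what the open cells miss lies on
    their boundaries, inside finitely many hyperplanes. *)
Lemma Omega_cells : exists N, [/\ measurable N, leb d N = 0%E &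
  Omega `<=` (\big[setU/set0]_(t : elt M) cell t) `|` N].
Proof.
have [N HN] := choice (fun t => bdry_null (cell_poly t)).
exists (\big[setU/set0]_(t : elt M) N t); split.
- by apply: bigsetU_measurable => t _; have [] := HN t.
- elim: (index_enum _) => [|t s IH]; first by rewrite big_nil measure0.
  have [mN N0 _] := HN t.
  rewrite big_cons null_set_setU//.
  by apply: bigsetU_measurable => q _; have [] := HN q.
- move=> x Ox; have [_ [_ cO] _ _ _] := hM.
  have : closure Omega x by exact: subset_closure.
  rewrite cO => -[t _ ctx]; rewrite -!bigcup_seq.
  have [xt|xt] := pselect (cell t x).
    by left; exists t => //=; rewrite mem_index_enum.
  right; exists t; rewrite /= ?mem_index_enum//.
  have [_ _] := HN t; apply; split=> //.
  have [[_ oc _ _] _] := cell_poly t.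
  by move/interior_id : oc => ->.
Qed.

Lemma Rintegral_cells (f : 'rV[R]_d -> R) : (leb d).-integrable Omega (EFin \o f) ->
  \int[leb d]_(x in Omega) f x = \sum_(t : elt M) \int[leb d]_(x in cell t) f x.
Proof.
move=> fi; have [oO bO mO _ _] := polyhedral_facts hOmega.
have mc t : measurable (cell t) by have [] := polyhedral_facts (cell_poly t).
have [N [mN N0 ON]] := Omega_cells.
have E x : Omega x -> ~ N x -> f x = \sum_(t : elt M) (f x * \1_(cell t) x).
  move=> Ox Nx; have [|//] := ON x Ox; rewrite -bigcup_seq => -[t _ tx].
  rewrite (bigD1 t)//= indicE mem_set// mulr1 big1 ?addr0// => t' t't.
  rewrite indicE (_ : _ \in _ = false) ?mulr0//; apply/negP; rewrite inE => t'x.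
  by have : (cell t' `&` cell t) x by []; rewrite cell_disj.
have fit t : (leb d).-integrable Omega (EFin \o (fun x => f x * \1_(cell t) x)).
  move/integrableP : (fi) => [mf _].
  apply: (le_integrable mO _ _ fi).
    apply/measurable_EFinP; apply: measurable_funM; first exact/measurable_EFinP.
    by apply: measurable_funTS; exact: measurable_indic.
  by move=> x _ /=; rewrite lee_fin normrM indicE; case: (_ \in _);
    rewrite ?normr1 ?normr0 ?mulr1 ?mulr0.
transitivity (\int[leb d]_(x in Omega) (\sum_(t : elt M) (f x * \1_(cell t) x))).
  apply: Rintegral_ae_eq => //.
  - by have /integrableP[/measurable_EFinP] := fi.
  - by apply: measurable_sum => t; have /integrableP[/measurable_EFinP] := fit t.
  - exists N; split=> // x /= /not_implyP[Ox]; apply: contra_notP; exact: E.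
rewrite Rintegral_sum//; apply: eq_bigr => t _.
rewrite -{2}(setIidr (@cell_sub t)) Rintegral_mkcondr.
apply: eq_Rintegral => x _; rewrite indicE patchE.
by case: ifP; rewrite ?mulr1 ?mulr0.
Qed.

End mesh_facts.

Section affine.
Context {R : realType}.

Lemma continuous_affine m n (a : 'rV[R]_n) (B : 'M[R]_(m, n)) :
  continuous (fun z : 'rV[R]_m => a + z *m B).
Proof.
move=> z P /rV_nbhsP[e e0 eP].
pose f i := dot (\row_k B k i) : 'rV[R]_m -> R.
have fE i z' : (a + z' *m B) ord0 i = a ord0 i + f i z'.
  rewrite !mxE; congr (_ + _); rewrite /f /dot.
  by apply: eq_bigr => k _; rewrite mxE mulrC.
have : \forall z' \near z, forall i, `|f i z - f i z'| < e.
  apply: (@filter_forall _ _ (fun i z' => `|f i z - f i z'| < e) (nbhs z)) => i.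
  apply: (@cvgr_dist_lt _ _ _ (nbhs z) _ (f i)) => //.
  exact: (@continuous_dot R _ (\row_k B k i) z).
by apply: filterS => z' Hz'; apply: eP => i; rewrite !fE opprD addrACA subrr add0r.
Qed.

Lemma measurable_affine m n (a : 'rV[R]_n) (B : 'M[R]_(m, n)) :
  measurable_fun setT (fun z : 'rV[R]_m => a + z *m B).
Proof.
apply: measurable_fun_rV => i.
apply: (@continuous_measurable_rV _ _ (fun z => (a + z *m B) ord0 i)) => // z.
apply: (@continuous_comp _ _ _ (fun z : 'rV[R]_m => a + z *m B) (fun x : 'rV[R]_n => x ord0 i)).
  exact: continuous_affine.
exact: coord_continuous.
Qed.

End affine.

(** * Boundary functionals built from traces *)

Section traces.
Context {R : realType} {d : nat} (Omega : set 'rV[R]_d) (M : mesh R d)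
  (H h gamma : R) (Nf : nat) (hM : is_mesh M Omega H h gamma Nf)
  (tr : elt M -> h1fun R d -> 'rV[R]_d -> R) (htr : trace_operator tr).
Implicit Types (t : elt M) (F : face M) (e : subface M) (u v w : h1fun R d).
Local Notation V := {ffun subface M -> R^o}.
Local Notation mu := (leb d.-1).

Definition trint t e w := \int[mu]_(z in sdom e) tr t w (face_map (par e) z).

Lemma fcstE t (c : V) w :
  fcst tr t c w = \sum_(e | par e \in faces t) c e * trint t e w.
Proof. by []. Qed.

Lemma fcst_lin t (a : R) (c c' : V) w :
  fcst tr t (a *: c + c') w = a * fcst tr t c w + fcst tr t c' w.
Proof.
rewrite /fcst mulr_sumr -big_split; apply: eq_bigr => e _ /=.
by rewrite !ffunE mulrDl mulrA.
Qed.

Lemma fcst0 t w : fcst tr t 0 w = 0.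
Proof. by rewrite /fcst big1// => e _; rewrite ffunE mul0r. Qed.

Lemma fcst_sum t (I : Type) (s : seq I) (P : pred I) (c : I -> V) w :
  fcst tr t (\sum_(i <- s | P i) c i) w = \sum_(i <- s | P i) fcst tr t (c i) w.
Proof.
elim: s => [|i s IH]; first by rewrite !big_nil fcst0.
rewrite !big_cons; case: ifP => // _.
by rewrite -[c i]scale1r fcst_lin IH scale1r mul1r.
Qed.

Lemma tr_L2 t e w : H1 (cell t) w -> par e \in faces t ->
  L2 (sdom e) (fun z => tr t w (face_map (par e) z)).
Proof.
move=> Hw et; have [/(_ w Hw _ et)[mt it] _ _ _] := htr t.
have [_ _ mF _ _] := polyhedral_facts (fdom_poly hM (par e)).
have [_ _ me _ _] := polyhedral_facts (sdom_poly hM e).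
have sF := sdom_sub hM (e := e); split.
  exact: measurable_funS mt.
exact: integrableS it.
Qed.

Lemma ae_sdom e (P : 'rV[R]_d.-1 -> Prop) :
  {ae mu, forall z, fdom (par e) z -> P z} -> {ae mu, forall z, sdom e z -> P z}.
Proof. by apply: filterS => z Pz ez; apply: Pz; exact: (sdom_sub hM). Qed.

Lemma trint_lin t e (a : R) u v : H1 (cell t) u -> H1 (cell t) v ->
  par e \in faces t -> trint t e (h1_lin a u v) = a * trint t e u + trint t e v.
Proof.
move=> Hu Hv et; have [_ bt mt _ _] := polyhedral_facts (cell_poly hM t).
have [_ _ me fe _] := polyhedral_facts (sdom_poly hM e).
have [mu1 iu] := tr_L2 Hu et; have [mv iv] := tr_L2 Hv et.
have Lu := sqint_integrable me fe (tr_L2 Hu et).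
have Lv := sqint_integrable me fe (tr_L2 Hv et).
have [ml _] := tr_L2 (H1_lin a mt bt Hu Hv) et.
rewrite /trint -RintegralZl// -RintegralD//; last exact: integrableZl_EFin.
apply: Rintegral_ae_eq => //.
  by apply: measurable_funD => //; exact: measurable_funM.
apply: ae_sdom.
by have [_ /(_ a u v Hu Hv (par e) et) + _ _] := htr t.
Qed.

(** Cauchy-Schwarz on the subface, whose share of the squared trace is at most that of its face,
    followed by the bound of the trace operator. *)
Lemma trint_sq t e : par e \in faces t ->
  exists C, forall w, H1 (cell t) w -> trint t e w ^+ 2 <= C * H1sqnorm (cell t) w.
Proof.
move=> et; have [_ _ [C HC] _] := htr t.
have [_ _ me fe e0] := polyhedral_facts (sdom_poly hM e).
have [_ _ mF _ _] := polyhedral_facts (fdom_poly hM (par e)).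
exists (fine (mu (sdom e)) * C) => w Hw.
apply: le_trans (Rintegral_sqr_le me fe (tr_L2 Hw et)) _.
rewrite -mulrA ler_pM2l//; apply: le_trans (HC w Hw).
rewrite (bigD1 (par e))//=.
apply: ler_wpDr; first by apply: sumr_ge0 => F _; apply: Rintegral_ge0 => z _; exact: sqr_ge0.
have [/(_ w Hw _ et)[mt it] _ _ _] := htr t.
rewrite -(setIidr (sdom_sub hM (e := e))) Rintegral_mkcondr.
apply: le_Rintegral => //.
  apply: (le_integrable mF _ _ it).
    apply/measurable_EFinP; apply/measurable_restrict => //.
    apply: measurable_funX; apply: measurable_funS mt => //.
  move=> z _; rewrite /= lee_fin patchE; case: ifP => // _.
  by rewrite normr0.
by move=> z _; rewrite patchE; case: ifP => // _; exact: sqr_ge0.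
Qed.

Lemma sum_sq_bound (I : Type) (s : seq I) (P : pred I) (W : Type) (Q : W -> Prop)
    (f : I -> W -> R) (N : W -> R) :
  (forall i, P i -> exists C, forall y, Q y -> f i y ^+ 2 <= C * N y) ->
  exists C, forall y, Q y -> (\sum_(i <- s | P i) f i y) ^+ 2 <= C * N y.
Proof.
move=> Hf; elim: s => [|i s [C HC]].
  by exists 0 => y _; rewrite big_nil expr0n mul0r.
case Pi : (P i); last by exists C => y Qy; rewrite big_cons Pi HC.
have [C' HC'] := Hf i Pi; exists (2 * (C' + C)) => y Qy; rewrite big_cons Pi.
have := HC y Qy; have := HC' y Qy; have := sqr_ge0 (f i y - \sum_(j <- s | P j) f j y).
by rewrite sqrrB sqrrD; lra.
Qed.

(** The gateway to [T], which is specified only on [H^{-1/2}] data. *)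
Lemma fcst_Hmhalf t (c : V) : Hmhalf tr t (fcst tr t c).
Proof.
split.
- move=> a u v Hu Hv; rewrite !fcstE mulr_sumr -big_split; apply: eq_bigr => e et /=.
  by rewrite trint_lin// mulrDr mulrCA.
- apply: sum_sq_bound => e et.
  have [C HC] := trint_sq et; exists (c e ^+ 2 * C) => w Hw.
  rewrite /= exprMn -[X in _ <= X]mulrA.
  by apply: ler_wpM2l; [exact: sqr_ge0|exact: HC].
- move=> w Hw tw0; rewrite fcstE big1// => e et.
  have [_ _ me _ _] := polyhedral_facts (sdom_poly hM e).
  suff -> : trint t e w = 0 by rewrite mulr0.
  transitivity (\int[mu]_(z in sdom e) cst 0 z); last by rewrite Rintegral_cst// mul0r.
  apply: Rintegral_ae_eq => //; first by have [] := tr_L2 Hw et.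
  by apply: ae_sdom; exact: tw0.
Qed.

(** The support condition on [v] concerns its values only. By the fundamental lemma the weak
    gradient vanishes too, hence the [H^1] norm, and the functional is bounded by that norm. *)
Lemma fcst_zero t (c : V) w : H1 (cell t) w ->
  {ae leb d, forall x, cell t x -> w.1 x = 0} -> fcst tr t c w = 0.
Proof.
move=> Hw w0; have [ot bt _ _ _] := polyhedral_facts (cell_poly hM t).
have [_ [C HC] _] := fcst_Hmhalf t c; have := HC w Hw.
rewrite (H1_zero_sqnorm ot bt Hw w0) mulr0 => l0.
by apply/eqP; rewrite -sqrf_eq0 eq_le l0 sqr_ge0.
Qed.

Lemma continuous_face_map F : continuous (@face_map R d M F).
Proof. exact: continuous_affine. Qed.

Lemma measurable_face_map F : measurable_fun setT (@face_map R d M F).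
Proof. exact: measurable_affine. Qed.

End traces.

Section dot_product.
Context {R : realType} {n : nat}.
Implicit Types (x y : 'rV[R]_n) (B : 'M[R]_n) (D : set 'rV[R]_n).

Lemma dotC x y : dot x y = dot y x.
Proof. by apply: eq_bigr => i _; rewrite mulrC. Qed.

Lemma dotE x y : dot x y = (x *m y^T) ord0 ord0.
Proof. by rewrite mxE; apply: eq_bigr => i _; rewrite mxE. Qed.

Lemma dot_mulmx x y B : dot (x *m B) y = dot x (y *m B^T).
Proof. by rewrite !dotE trmx_mul trmxK mulmxA. Qed.

Lemma enorm_sqr x : enorm x ^+ 2 = dot x x.
Proof. by rewrite sqr_sqrtr// sumr_ge0// => i _; rewrite -expr2 sqr_ge0. Qed.

Lemma measurable_dot D (f g : 'rV[R]_n -> 'rV[R]_n) :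
  (forall i, measurable_fun D (fun x => f x ord0 i)) ->
  (forall i, measurable_fun D (fun x => g x ord0 i)) ->
  measurable_fun D (fun x => dot (f x) (g x)).
Proof. by move=> mf mg; apply: measurable_sum => i; exact: measurable_funM. Qed.

Lemma measurable_mulmx D (f : 'rV[R]_n -> 'rV[R]_n) (B : 'rV[R]_n -> 'M[R]_n) :
  (forall i, measurable_fun D (fun x => f x ord0 i)) ->
  (forall i j, measurable_fun D (fun x => B x i j)) ->
  forall i, measurable_fun D (fun x => (f x *m B x) ord0 i).
Proof.
move=> mf mB i; under eq_fun do rewrite mxE.
by apply: measurable_sum => k; exact: measurable_funM.
Qed.

End dot_product.

(** * Energy forms of the solution operator *)

Section solution_operator_facts.
Context {R : realType} {d : nat} (Omega : set 'rV[R]_d)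
  (hOmega : polyhedral_domain Omega)
  (A Ah : 'rV[R]_d -> 'M[R]_d) (amin amax : R) (am ap : 'rV[R]_d -> R)
  (hA : elliptic_tensor Omega A Ah amin amax am ap) (M : mesh R d)
  (H h gamma : R) (Nf : nat) (hM : is_mesh M Omega H h gamma Nf)
  (tr : elt M -> h1fun R d -> 'rV[R]_d -> R) (htr : trace_operator tr)
  (T : elt M -> (h1fun R d -> R) -> h1fun R d) (hT : solution_operator tr A T).
Implicit Types (t : elt M) (u v w : h1fun R d).
Local Notation V := {ffun subface M -> R^o}.

Definition grad_meas t w := forall i, measurable_fun (cell t) (fun x => w.2 x ord0 i).

Lemma H1_grad_meas t w : H1 (cell t) w -> grad_meas t w.
Proof. by move=> [_ w2 _] i; have [] := w2 i. Qed.

Definition aform t u v := \int[leb d]_(x in cell t) dot (u.2 x *m A x) (v.2 x).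

Let mcell t : measurable (cell t).
Proof. by have [] := polyhedral_facts (cell_poly hM t). Qed.

Lemma A_meas t i j : measurable_fun (cell t) (fun x => A x i j).
Proof.
have [_ mA _ _ _] := hA; have [_ _ mO _ _] := polyhedral_facts hOmega.
by apply: measurable_funS (mA i j) => //; exact: (cell_sub hM).
Qed.

Lemma Ah_meas t i j : measurable_fun (cell t) (fun x => Ah x i j).
Proof.
have [_ _ _ _ [mA _]] := hA; have [_ _ mO _ _] := polyhedral_facts hOmega.
by apply: measurable_funS (mA i j) => //; exact: (cell_sub hM).
Qed.

Lemma aform_meas t u v : grad_meas t u -> grad_meas t v ->
  measurable_fun (cell t) (fun x => dot (u.2 x *m A x) (v.2 x)).
Proof.
move=> mu mv; apply: measurable_dot => //; apply: measurable_mulmx => // i j.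
exact: A_meas.
Qed.

Lemma aform_sym t u v : grad_meas t u -> grad_meas t v -> aform t u v = aform t v u.
Proof.
move=> mu mv; apply: Rintegral_ae_eq => //; [exact: aform_meas|exact: aform_meas|].
have [_ _ _ A4 _] := hA; apply: filterS A4 => x Ax tx.
by have [AT _ _ _] := Ax (cell_sub hM tx); rewrite dot_mulmx AT dotC.
Qed.

Lemma aform_energy t w : grad_meas t w ->
  \int[leb d]_(x in cell t) (enorm (w.2 x *m Ah x) ^+ 2) = aform t w w.
Proof.
move=> mw; under eq_Rintegral do rewrite enorm_sqr.
apply: Rintegral_ae_eq => //; last first.
- have [_ _ _ _ [_ A5]] := hA; apply: filterS A5 => x Ax tx.
  have [AhT _ AhA] := Ax (cell_sub hM tx).
  by rewrite dot_mulmx AhT -mulmxA AhA dotC.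
- exact: aform_meas.
- have mwA := measurable_mulmx mw (fun i j => @Ah_meas t i j).
  exact: measurable_dot.
Qed.

Lemma aform_ge0 t w : grad_meas t w -> 0 <= aform t w w.
Proof.
move=> mw; rewrite -aform_energy//; apply: Rintegral_ge0 => x _; exact: sqr_ge0.
Qed.

Definition Tc t (c : V) := T t (fcst tr t c).

Lemma Tc_mean0 t (c : V) : H1mean0 (cell t) (Tc t c).
Proof. by have [] := hT (fcst_Hmhalf hM htr t c). Qed.

Lemma Tc_meas t (c : V) : grad_meas t (Tc t c).
Proof. by apply: H1_grad_meas; have [] := Tc_mean0 t c. Qed.

Lemma aform_Tc t (c : V) w : H1mean0 (cell t) w -> aform t (Tc t c) w = fcst tr t c w.
Proof. by have [_ +] := hT (fcst_Hmhalf hM htr t c); apply. Qed.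

(** Testing the equation of [T a] with [T b] identifies the boundary form with the energy product of
    the two solutions, which makes it symmetric and positive semidefinite. *)
Lemma TformE t (a b : V) : Tform tr T t a b = aform t (Tc t b) (Tc t a).
Proof.
rewrite aform_sym; [|exact: Tc_meas|exact: Tc_meas].
by rewrite aform_Tc//; exact: Tc_mean0.
Qed.

Lemma Tform_sym t (a b : V) : Tform tr T t a b = Tform tr T t b a.
Proof. by rewrite !TformE aform_sym//; exact: Tc_meas. Qed.

Lemma Tform_ge0 t (a : V) : 0 <= Tform tr T t a a.
Proof. by rewrite TformE aform_ge0//; exact: Tc_meas. Qed.

Lemma Tform_linl t (k : R) (a b c : V) :
  Tform tr T t (k *: a + b) c = k * Tform tr T t a c + Tform tr T t b c.
Proof. exact: fcst_lin. Qed.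

Lemma energyE (S : {set elt M}) (c : elt M -> V) :
  energy Ah S (fun t => T t (fcst tr t (c t))) = \sum_(t in S) Tform tr T t (c t) (c t).
Proof.
apply: eq_bigr => t _; rewrite TformE -aform_energy//; exact: Tc_meas.
Qed.

End solution_operator_facts.

(** * Normal traces constant on subfaces *)

Section L2_patches.
Context {R : realType} {n : nat}.

Lemma L2_patch (D E : set 'rV[R]_n) (f : 'rV[R]_n -> R) :
  measurable D -> measurable E -> D `<=` E -> L2 D f -> L2 E (fun x => \1_D x * f x).
Proof.
move=> mD mE DE [mf f2].
have pE : (fun x => \1_D x * f x) = f \_ D.
  apply/funext => x; rewrite patchE indicE.
  by case: ifP; rewrite ?mul1r ?mul0r.
rewrite pE; split; first by apply/measurable_restrict => //; rewrite setIidr.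
have : (leb n).-integrable E ((fun x => (f x ^+ 2)%:E) \_ D).
  by apply/integrable_restrict => //; rewrite setIidr.
apply: eq_integrable => // x _; rewrite !patchE.
by case: ifP => // _; rewrite expr0n.
Qed.

End L2_patches.

Section normal_traces.
Context {R : realType} {d : nat} (Omega : set 'rV[R]_d)
  (hOmega : polyhedral_domain Omega)
  (A Ah : 'rV[R]_d -> 'M[R]_d) (amin amax : R) (am ap : 'rV[R]_d -> R)
  (hA : elliptic_tensor Omega A Ah amin amax am ap) (M : mesh R d)
  (H h gamma : R) (Nf : nat) (hM : is_mesh M Omega H h gamma Nf)
  (tr : elt M -> h1fun R d -> 'rV[R]_d -> R) (htr : trace_operator tr)
  (T : elt M -> (h1fun R d -> R) -> h1fun R d) (hT : solution_operator tr A T).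
Implicit Types (t : elt M) (F : face M) (e : subface M) (u v w : h1fun R d).
Local Notation V := {ffun subface M -> R^o}.
Local Notation sleb e := (fine (leb d.-1 (sdom e))).

(** The trace operator is abstract; its agreement with restriction on C^1 functions is what allows
    traces to be computed. *)
Lemma trint_C1 t e (phi : 'rV[R]_d -> R) : C1 phi -> par e \in faces t ->
  trint tr t e (phi, grad phi) =
  \int[leb d.-1]_(z in sdom e) phi (face_map (par e) z).
Proof.
move=> Cphi et; have [ot bt mt _ _] := polyhedral_facts (cell_poly hM t).
have [oe be me _ _] := polyhedral_facts (sdom_poly hM e).
apply: Rintegral_ae_eq => //.
- by have [] := tr_L2 hM htr (H1_C1 ot bt Cphi) et.
- apply: (@measurable_funS _ _ _ _ setT) => //.
  apply: (@measurableT_comp _ _ _ _ _ _ phi); last exact: measurable_face_map.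
  by apply: continuous_measurable_rV => //; exact: C1_continuous.
- apply: (ae_sdom hM).
  by have [_ _ _ /(_ phi Cphi _ et)] := htr t.
Qed.

Lemma trint_cst t e (a : R) : par e \in faces t ->
  trint tr t e (cst a, cst 0) = a * sleb e.
Proof.
move=> et; rewrite -(grad_cst a) trint_C1//; last exact: (C1_cst a).1.
have [_ _ me _ _] := polyhedral_facts (sdom_poly hM e).
exact: Rintegral_cst.
Qed.

Lemma fcst_cst t (c : V) (a : R) :
  (forall F, F \in faces t -> \sum_(e | par e == F) c e * sleb e = 0) ->
  fcst tr t c (cst a, cst 0) = 0.
Proof.
move=> c0; rewrite fcstE (partition_big (@par R d M) (mem (faces t)))//= big1// => F Ft.
transitivity (a * \sum_(e | par e == F) c e * sleb e); last by rewrite c0// mulr0.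
rewrite mulr_sumr; apply: eq_big => [e|e /andP[et _]].
  by case: eqP => [->|]; rewrite ?Ft// andbF.
by rewrite trint_cst// mulrCA.
Qed.

Definition face_int (phi : 'rV[R]_d -> R) e :=
  \int[leb d.-1]_(z in sdom e) phi (face_map (par e) z).

Definition side_support (c : elt M -> V) :=
  forall t e, par e \notin faces t -> c t e = 0.

(** A C^1 function has the same trace from both sides of a face, so only the sums [\sum_t c t e] of
    one-sided values remain. *)
Lemma sum_fcst_C1 (c : elt M -> V) (phi : 'rV[R]_d -> R) : C1 phi ->
  side_support c ->
  \sum_(t : elt M) fcst tr t (c t) (phi, grad phi) = \sum_(e : subface M) (\sum_(t : elt M) c t e) * face_int phi e.
Proof.
move=> Cphi sc; transitivity (\sum_(t : elt M) \sum_(e : subface M) c t e * face_int phi e).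
  apply: eq_bigr => t _; rewrite fcstE big_mkcond; apply: eq_bigr => e _.
  by case: ifPn => et; [rewrite trint_C1|rewrite sc// mul0r].
by rewrite exchange_big; apply: eq_bigr => e _; rewrite mulr_suml.
Qed.

Lemma dot_integrable (D : set 'rV[R]_d) (f g : 'rV[R]_d -> 'rV[R]_d) : measurable D ->
  (forall i, L2 D (fun x => f x ord0 i)) -> (forall i, L2 D (fun x => g x ord0 i)) ->
  (leb d).-integrable D (EFin \o (fun x => dot (f x) (g x))).
Proof.
move=> mD Lf Lg; have : (leb d).-integrable D
    (fun x => (\sum_(i <- index_enum 'I_d) (f x ord0 i * g x ord0 i)%:E)%E).
  by apply: integrable_sum => // i _; exact: (sqint_prod mD (Lf i) (Lg i)).
by apply: eq_integrable => // x _; rewrite sumEFin.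
Qed.

Lemma grad_L2 (D : set 'rV[R]_d) (phi : 'rV[R]_d -> R) i : measurable D ->
  bounded_set D -> C1 phi -> L2 D (fun x => grad phi x ord0 i).
Proof.
move=> mD bD Cphi; under eq_fun do rewrite mxE.
by apply: continuous_L2 => //; have [] := Cphi i.
Qed.

(** The Green formulas of the elements add up to that of [Omega], where a test function leaves no
    boundary term. *)
Lemma sum_fcst_Lambda (c : elt M -> V) (phi : 'rV[R]_d -> R) :
  Lambda Omega (fun t => fcst tr t (c t)) -> test_fun Omega phi ->
  \sum_(t : elt M) fcst tr t (c t) (phi, grad phi) = 0.
Proof.
move=> [s [q [[Ls Lq sq] cs]]] tphi; have [Cphi _ _] := tphi.
have [oO bO mO _ _] := polyhedral_facts hOmega.
have Lphi : L2 Omega phi by apply: continuous_L2 => //; exact: C1_continuous.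
have i1 := dot_integrable mO Ls (fun i => grad_L2 i mO bO Cphi).
have i2 := sqint_prod mO Lq Lphi.
transitivity (\int[leb d]_(x in Omega) (dot (s x) (grad phi x) + q x * phi x)).
  rewrite (Rintegral_cells hOmega hM); last exact: integrableD_EFin.
  apply: eq_bigr => t _; rewrite cs//.
  have [ot bt _ _ _] := polyhedral_facts (cell_poly hM t).
  exact: H1_C1.
by rewrite RintegralD// sq// addNr.
Qed.

(** The sum over [e] of [C e] times the integral of [phi] on [e] is 0 for every test function. The
    monotone class theorem extends this to indicators of Borel sets inside a box around a point of
    [e0]. Taking [e0] itself as the Borel set removes all other subfaces and leaves [C e0] times the
    measure of a nonempty relatively open piece [S] of [e0]. *)
Lemma Lambda_opposite (c : elt M -> V) : side_support c ->
  Lambda Omega (fun t => fcst tr t (c t)) ->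
  forall e, face_set (par e) `<=` Omega -> \sum_(t : elt M) c t e = 0.
Proof.
move=> sc Lc e0 e0O; pose C e := \sum_(t : elt M) c t e.
have [oO bO mO _ _] := polyhedral_facts hOmega.
have poly e := polyhedral_facts (sdom_poly hM e).
have ms e : measurable (sdom e) by have [] := poly e.
have iC e : (leb d.-1).-integrable (sdom e) (EFin \o (fun=> C e)).
  by have [_ _ _ fe _] := poly e; exact: integrable_cst_fin.
have [[[z0 ez0] _ _ _] _] := sdom_poly hM e0.
pose F0 := par e0; pose x0 := face_map F0 z0.
have Ox0 : Omega x0 by apply: e0O; exists z0 => //; exact: (sdom_sub hM).
have [p [px0 pO]] := open_rat_box oO Ox0.
pose a : 'rV[R]_d := map_mx ratr p.1; pose b : 'rV[R]_d := map_mx ratr p.2.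
have [_ ub] := bump_unit a b.
have uc := @unit_closed_integral R d _ _ (leb d.-1) _ (index_enum (subface M)) _
  (fun e => @face_map R d M (par e)) (fun e => fun=> C e) ms
  (fun e => @measurable_face_map R d M (par e)) iC.
have H0 := test_monotone_class uc _ (bump_test pO) ub.
(* E is the subface e0 as a subset of R^d, described through the left inverse g
   of its parametrization to make its measurability visible. *)
pose g (x : 'rV[R]_d) := - forg F0 *m (ffrm F0)^T + x *m (ffrm F0)^T.
have gK z : g (face_map F0 z) = z.
  by rewrite /g -mulmxDl addrC (face_mapK hM).
pose E := (g @^-1` sdom e0) `&`
  ((fun x => dot (x - face_map F0 (g x)) (x - face_map F0 (g x))) @^-1` [set 0]).
have mg : measurable_fun setT g by exact: measurable_affine.
have mE : measurable E.
  apply: measurableI; rewrite -[X in measurable X]setTI.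
    exact: mg.
  have mi i : measurable_fun setT (fun x : 'rV[R]_d => (x - face_map F0 (g x)) ord0 i).
    rewrite (_ : (fun x => _) =
        fun x : 'rV[R]_d => x ord0 i - face_map F0 (g x) ord0 i); last first.
      by apply/funext => x; rewrite mxE [X in _ + X]mxE.
    apply: measurable_funB; first exact: measurable_rV_coord.
    exact: (measurableT_comp (measurable_rV_coord i)
      (measurableT_comp (@measurable_face_map R d M F0) mg)).
  exact: (measurable_dot mi mi).
have Ein z : sdom e0 z -> E (face_map F0 z).
  by move=> ez; rewrite /E/= gK subrr; split=> //; rewrite /dot big1// => i _; rewrite mxE mul0r.
have Eout x : E x -> exists2 z, sdom e0 z & x = face_map F0 z.
  move=> [gx /= xg]; exists (g x) => //; apply/eqP; rewrite -subr_eq0; apply/eqP.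
  move: xg; rewrite /dot; set y := x - _ => /eqP.
  rewrite psumr_eq0; last by move=> i _; rewrite -expr2 sqr_ge0.
  move=> /allP y0; apply/rowP => i; rewrite [RHS]mxE.
  by have := y0 i (mem_index_enum i); rewrite mulf_eq0 orbb => /eqP.
have [_ _ [_ disF _ _] _ [_ dise _]] := hM.
have Eother e z : e != e0 -> sdom e z -> ~ E (face_map (par e) z).
  move=> ee0 ez /Eout[z' ez' zz'].
  have [pp|pp] := eqVneq (par e) F0.
    have zz : z = z' by rewrite -(face_mapK hM (par e) z) zz' pp (face_mapK hM).
    have : (sdom e `&` sdom e0) z by split=> //; rewrite zz.
    by rewrite dise.
  have : (face_set (par e) `&` face_set F0) (face_map (par e) z).
    split; first by exists z => //; exact: (sdom_sub hM).
    by rewrite zz'; exists z' => //; exact: (sdom_sub hM).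
  by rewrite disF.
have Htest phi : test_fun Omega phi -> unit_range phi ->
    \sum_(e : subface M) \int[leb d.-1]_(z in sdom e) (C e * phi (face_map (par e) z)) = 0.
  move=> tphi _; have [Cphi _ _] := tphi.
  rewrite -[RHS](sum_fcst_Lambda Lc tphi) sum_fcst_C1//.
  apply: eq_bigr => e _; rewrite RintegralZl//.
  have [oe be me _ _] := poly e.
  apply: (@continuous_bounded_integrable _ _ _ (fun z => phi (face_map (par e) z))) => //.
  move=> z; apply: (@continuous_comp _ _ _ (@face_map R d M (par e)) phi).
    exact: continuous_face_map.
  exact: C1_continuous.
have := H0 Htest E mE.
rewrite (bigD1 e0)//= big1 ?addr0; last first.
  move=> e ee0; transitivity (\int[leb d.-1]_(z in sdom e) cst 0 z).
    apply: eq_Rintegral => z; rewrite inE => ez; rewrite indicE memNset ?mulr0//.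
    by move=> [+ _]; exact: Eother.
  by rewrite Rintegral_cst// mul0r.
pose S := face_map F0 @^-1` obox a b.
have oS : open S.
  apply: open_comp => [z _|]; first exact: continuous_face_map.
  exact: open_obox.
have [oe0 be0 me0 fe0 _] := poly e0.
have mS := measurable_open_rV oS.
have -> : \int[leb d.-1]_(z in sdom e0)
    (C e0 * \1_(E `&` [set x | bump a b x != 0]) (face_map F0 z)) =
    C e0 * fine (leb d.-1 (sdom e0 `&` S)).
  rewrite -Rintegral_cst; last exact: measurableI.
  rewrite Rintegral_mkcondr; apply: eq_Rintegral => z; rewrite inE => ez.
  rewrite bump_neq0 indicE patchE; have [zS|zS] := boolP (z \in S).
    rewrite mem_set ?mulr1//; split; first exact: Ein.
    by rewrite inE in zS.
  by rewrite memNset ?mulr0// => -[_ zS']; move/negP: zS; apply; rewrite inE.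
have m0 : 0 < fine (leb d.-1 (sdom e0 `&` S)).
  rewrite fine_gt0//; apply/andP; split.
    apply: leb_open_gt0; first exact: openI.
    by exists z0; split=> //; rewrite /S/=.
  apply: le_lt_trans fe0; apply: le_measure; rewrite ?inE//.
  exact: measurableI.
by move/eqP; rewrite mulf_eq0 (gt_eqF m0) orbF => /eqP.
Qed.

(** [T] is specified against functions of zero mean only. Subtracting the mean of [v] does not
    change its gradient, nor the right-hand side, because data with zero mean on each face
    annihilate constants. *)
Lemma weak_form_full t (c : V) v :
  (forall F, F \in faces t -> \sum_(e | par e == F) c e * sleb e = 0) ->
  H1 (cell t) v -> aform A t (Tc tr T t c) v = fcst tr t c v.
Proof.
move=> c0 Hv; have [ot bt mt ft t0] := polyhedral_facts (cell_poly hM t).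
pose m := (\int[leb d]_(x in cell t) v.1 x) / fine (leb d (cell t)).
pose w := h1_lin (- m) (cst 1, cst 0) v.
have H1c := H1_cst 1 ot bt.
have Hw : H1 (cell t) w by exact: H1_lin.
have iv : (leb d).-integrable (cell t) (EFin \o v.1).
  by have [v1 _ _] := Hv; exact: (sqint_integrable mt ft v1).
have w0 : H1mean0 (cell t) w.
  split=> //; rewrite /w /= RintegralD//; last first.
    by apply: integrableZl_EFin => //; exact: (integrable_cst_fin mt ft 1).
  rewrite (_ : \int[leb d]_(x in cell t) (- m * 1) = - m * fine (leb d (cell t))).
    by rewrite mulNr /m divfK ?gt_eqF// addNr.
  by rewrite Rintegral_cst// mulr1.
have -> : aform A t (Tc tr T t c) v = aform A t (Tc tr T t c) w.
  by apply: eq_Rintegral => x _; rewrite /w/= scaler0 add0r.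
rewrite (aform_Tc hM htr hT c w0).
have [lin _ _] := fcst_Hmhalf hM htr t c.
by rewrite lin// fcst_cst// mulr0 add0r.
Qed.

Lemma flux_L2 t w i : H1 (cell t) w -> L2 (cell t) (fun x => (w.2 x *m A x) ord0 i).
Proof.
move=> [_ w2 _]; under eq_fun do rewrite mxE.
have [_ _ mt _ _] := polyhedral_facts (cell_poly hM t).
apply: sqint_sum => // k _; under eq_fun do rewrite mulrC.
have [_ _ /(_ k i)[C AC] _ _] := hA.
apply: (@sqint_ae_bounded _ _ _ _ _ mt _ _ C) => //; last exact: w2.
  exact: (A_meas hOmega hA hM).
by apply: filterS AC => x Ax tx; exact: (Ax (cell_sub hM tx)).
Qed.

Lemma opposite_Lambda (c : elt M -> V) : side_support c ->
  (forall e, face_set (par e) `<=` Omega -> \sum_(t : elt M) c t e = 0) ->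
  (forall t F, F \in faces t -> \sum_(e | par e == F) c t e * sleb e = 0) ->
  Lambda Omega (fun t => fcst tr t (c t)).
Proof.
move=> sc oc c0; have [oO bO mO _ _] := polyhedral_facts hOmega.
have mc t : measurable (cell t) by have [] := polyhedral_facts (cell_poly hM t).
(* The field is the flux of T c on each element, with divergence 0: it has
   normal trace c t on the element t because c t has zero mean on each face. *)
pose flux t x := (Tc tr T t (c t)).2 x *m A x.
pose s x := \sum_(t : elt M) (\1_(cell t) x : R) *: flux t x.
have sE t x : cell t x -> s x = flux t x.
  move=> tx; rewrite /s (bigD1 t)//= indicE mem_set// scale1r big1 ?addr0// => t' t't.
  rewrite indicE memNset ?scale0r// => t'x.
  by have : (cell t' `&` cell t) x by []; rewrite (cell_disj hM).
have HT t : H1 (cell t) (Tc tr T t (c t)) by have [] := Tc_mean0 hM htr hT t (c t).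
have sL i : L2 Omega (fun x => s x ord0 i).
  rewrite (_ : (fun x => _) = fun x => \sum_(t : elt M) \1_(cell t) x * flux t x ord0 i).
    apply: sqint_sum => // t _.
    apply: L2_patch => //; [exact: (cell_sub hM)|exact: flux_L2].
  by apply/funext => x; rewrite /s summxE; apply: eq_bigr => t _; rewrite mxE.
exists s, (cst 0); split; last first.
  move=> t v Hv; rewrite -weak_form_full//; last by move=> F Ft; exact: c0.
  by apply: eq_Rintegral => x; rewrite inE => tx; rewrite mul0r addr0 (sE t).
split=> //.
  have [_ _ _ fO _] := polyhedral_facts hOmega; exact: (sqint_cst mO fO 0).
move=> phi tphi; have [Cphi _ _] := tphi.
rewrite (_ : \int[leb d]_(x in Omega) (cst 0 x * phi x) = 0); last first.
  under eq_Rintegral do rewrite mul0r.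
  by rewrite Rintegral_cst// mul0r.
rewrite oppr0 (Rintegral_cells hOmega hM); last first.
  by apply: dot_integrable => // i; exact: grad_L2.
transitivity (\sum_(t : elt M) fcst tr t (c t) (phi, grad phi)).
  apply: eq_bigr => t _; rewrite -weak_form_full//; last first.
  - by have [? ? _ _ _] := polyhedral_facts (cell_poly hM t); exact: H1_C1.
  - by move=> F Ft; exact: c0.
  by apply: eq_Rintegral => x; rewrite inE => tx; rewrite (sE t).
rewrite sum_fcst_C1// big1// => e _.
(* On interior faces the opposite values cancel; on boundary faces it is the test function that
   vanishes, its support lying in the open set [Omega]. *)
have [_ _ [_ _ _ /(_ (par e))[[_ eO]|[_ eO]]] _ _] := hM; last by rewrite oc// mul0r.
suff -> : face_int phi e = 0 by rewrite mulr0.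
have [_ _ me _ _] := polyhedral_facts (sdom_poly hM e).
transitivity (\int[leb d.-1]_(z in sdom e) cst 0 z); last by rewrite Rintegral_cst// mul0r.
apply: eq_Rintegral => z; rewrite inE => ez.
apply: (test_fun_out tphi _).1 => Oz.
have : bdry Omega (face_map (par e) z).
  by apply: eO; exists z => //; exact: (sdom_sub hM).
by move=> [_]; apply; move/interior_id : oO => ->.
Qed.

(** Trades the existence of a field for linear conditions on the values, each involving a single
    face or subface. *)
Lemma Lambda_hfP (c : elt M -> V) : Lambda_hf Omega tr c <->
  [/\ side_support c,
      forall e, face_set (par e) `<=` Omega -> \sum_(t : elt M) c t e = 0 &
      forall t F, F \in faces t -> \sum_(e | par e == F) c t e * sleb e = 0].
Proof.
split=> [[[[sc Lc] _] c0]|[sc oc c0]]; first by split=> //; exact: Lambda_opposite.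
split=> //; split; first by split=> //; exact: opposite_Lambda.
by move=> a; rewrite big1// => t _; apply: fcst_cst => F Ft; exact: c0.
Qed.

End normal_traces.

(** * Schur complements and spectral bounds *)

Section semidefinite_forms.
Context {R : realFieldType} {V : vectType R}.
Implicit Types (B : V -> V -> R) (u v w x y m : V) (X : seq V).

Definition bilin_sym B := (forall k u v w, B (k *: u + v) w = k * B u w + B v w) /\
  forall u v, B u v = B v u.

Definition psd B := bilin_sym B /\ forall u, 0 <= B u u.

Lemma bilin_symDr B k u v w : bilin_sym B -> B w (k *: u + v) = k * B w u + B w v.
Proof. by move=> [lB sB]; rewrite sB lB !(sB w). Qed.

Lemma bilin_sym0 B u : bilin_sym B -> B 0 u = 0.
Proof.
by move=> [lB _]; have := lB (-1) 0 0 u; rewrite scaler0 addr0 mulN1r addNr.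
Qed.

Lemma bilin_sym_sumr B (I : Type) (r : seq I) (P : pred I) (xi : I -> R) (f : I -> V) w :
  bilin_sym B -> B w (\sum_(i <- r | P i) xi i *: f i) = \sum_(i <- r | P i) xi i * B w (f i).
Proof.
move=> bB; elim: r => [|i r IH]; first by rewrite !big_nil (proj2 bB) bilin_sym0.
by rewrite !big_cons; case: ifP => // _; rewrite bilin_symDr// IH.
Qed.

Lemma bilin_symDD B u v : bilin_sym B -> B (u + v) (u + v) = B u u + 2 * B u v + B v v.
Proof.
move=> bB; have [lB sB] := bB.
rewrite -[X in B (X + _)]scale1r -[X in B _ (X + _)]scale1r lB !bilin_symDr//.
by rewrite (sB v u) !mul1r; ring.
Qed.

Lemma bilin_symZ B k u v : bilin_sym B -> B (k *: u) v = k * B u v.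
Proof. by move=> bB; rewrite -[k *: u]addr0 (proj1 bB) bilin_sym0// addr0. Qed.

Lemma bilin_symNN B u : bilin_sym B -> B (- u) (- u) = B u u.
Proof.
move=> bB; rewrite -scaleN1r bilin_symZ// (proj2 bB) bilin_symZ//.
by rewrite !mulN1r opprK.
Qed.

Lemma psd_isotropic B u v : psd B -> B u u = 0 -> B u v = 0.
Proof.
move=> [bB B0] u0; apply/eqP/negPn/negP => uv0.
(* Chosen so that [B (k u + v) (k u + v)] equals -1. *)
pose k := - (B v v + 1) / (2 * B u v).
have := B0 (k *: u + v); rewrite bilin_symDD// !(bilin_symZ _ _ _ bB).
rewrite (proj2 bB) (bilin_symZ _ _ _ bB) u0 !mulr0 add0r.
have -> : 2 * (k * B u v) = - (B v v + 1) by rewrite /k; field.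
lra.
Qed.

Lemma psd_young B u v : psd B -> 2 * B u v <= B u u + B v v.
Proof.
move=> [bB B0]; have := B0 (-1 *: u + v); rewrite bilin_symDD//.
by rewrite !(bilin_symZ _ _ _ bB) (proj2 bB _ (-1 *: u)) (bilin_symZ _ _ _ bB); lra.
Qed.

(* Gram-Schmidt; isotropic directions can be skipped by [psd_isotropic]. *)
Lemma psd_projection B X m : psd B ->
  exists2 w, w \in <<X>>%VS & forall x, x \in <<X>>%VS -> B x w = B x m.
Proof.
move=> pB; have [bB B0] := pB; elim: X m => [|u X IH] m.
  exists 0; first exact: mem0v.
  by move=> x; rewrite span_nil memv0 => /eqP ->; rewrite !bilin_sym0.
have [w1 w1s w1m] := IH m; have [u1 u1s u1u] := IH u.
pose u' := -1 *: u1 + u.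
have u's x : x \in <<X>>%VS -> B x u' = 0.
  by move=> xs; rewrite bilin_symDr// u1u// mulN1r addNr.
have sub x : x \in <<X>>%VS -> x \in <<u :: X>>%VS.
  by move=> xs; rewrite span_cons; apply: subvP xs; exact: addvSr.
have us : u \in <<u :: X>>%VS by apply: memv_span; rewrite mem_head.
have u'us : u' \in <<u :: X>>%VS by apply: memvD => //; apply: memvZ; exact: sub.
have dec x : x \in <<u :: X>>%VS -> exists k y, y \in <<X>>%VS /\ x = k *: u' + y.
  rewrite span_cons => /memv_addP[_ /vlineP[k ->] [y ys ->]].
  exists k, (k *: u1 + y); split; first by rewrite memvD// memvZ.
  by rewrite /u' scalerDr scaleN1r scalerN addrACA addNr add0r.
have [u'0|u'0] := eqVneq (B u' u') 0.
  exists w1; first exact: sub.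
  move=> x /dec[k [y [ys ->]]]; rewrite !(proj1 bB k u' y) (w1m y)//.
  by rewrite !(psd_isotropic _ pB u'0) ?mulr0.
pose k := (B u' m - B u' w1) / B u' u'.
exists (k *: u' + w1); first by apply: memvD; [exact: memvZ|exact: sub].
move=> x /dec[l [y [ys ->]]]; rewrite !(proj1 bB l u' y) !(bilin_symDr k u' w1)// (w1m y)// (u's y)//.
by rewrite /k divfK// subrK mulr0 add0r.
Qed.

(** Turns the restricted spaces, given as predicates, into spans: a free family in [P] of maximal
    size spans [P], and the ambient dimension bounds that size. *)
Lemma subspace_span (P : V -> Prop) : P 0 -> (forall k u v, P u -> P v -> P (k *: u + v)) ->
  exists X, forall x, P x <-> x \in <<X>>%VS.
Proof.
move=> P0 PD.
have spanP X : (forall x, x \in X -> P x) -> forall x, x \in <<X>>%VS -> P x.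
  elim: X => [|u X IH] Ps x; first by rewrite span_nil memv0 => /eqP ->.
  rewrite span_cons => /memv_addP[_ /vlineP[k ->] [y ys ->]]; apply: PD.
    by apply: Ps; rewrite mem_head.
  by apply: IH => // z zs; apply: Ps; rewrite in_cons zs orbT.
pose Q k := `[< exists X, [/\ size X = k, free X & forall x, x \in X -> P x] >].
have Q0 : exists k, Q k.
  by exists 0%N; apply/asboolP; exists [::]; split=> //; exact: nil_free.
have Qle k : Q k -> (k <= \dim {:V})%N.
  by move/asboolP => [X [<- /eqP <- _]]; exact: dimvS (subvf _).
have [k /asboolP[X [sk fs Ps]] kmax] := ex_maxnP Q0 Qle.
exists X => x; split=> [Px|]; last exact: spanP.
apply/negPn/negP => xs; have : Q k.+1.
  apply/asboolP; exists (x :: X); split=> [/=||y]; first by rewrite sk.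
    by rewrite free_cons xs.
  by rewrite in_cons => /predU1P[->|/Ps].
by move/kmax; rewrite ltnn.
Qed.

Section schur.
Variables (B : V -> V -> R) (pB : psd B) (W : V -> Prop) (sol : V -> V).
Hypothesis WD : forall k u v, W u -> W v -> W (k *: u + v).
Hypothesis sol_in : forall m, W (sol m).
Hypothesis solP : forall m x, W x -> B x (sol m) = B x m.

Definition schur_form u v := B u v - B u (sol v).

(** [sol] is not assumed linear, since projections are not unique for a degenerate [B]. The form is
    linear in its first argument by definition, symmetric by the projection property, and hence
    bilinear. *)
Lemma schur_bilin_sym : bilin_sym schur_form.
Proof.
have [bB _] := pB; split=> [k u v w|u v].
  by rewrite /schur_form !(proj1 bB); ring.
rewrite /schur_form (proj2 bB u v); congr (_ - _).
rewrite (proj2 bB u) -(solP u (sol_in v)) (proj2 bB (sol v)).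
by rewrite (solP v (sol_in u)) (proj2 bB).
Qed.

(** Pythagoras: [x - sol x] is [B]-orthogonal to [W], so it has the least energy in [x + W], and
    this energy is the Schur form of [x]. *)
Lemma schur_form_le x y : W y -> schur_form x x <= B (x + y) (x + y).
Proof.
move=> Wy; have [bB B0] := pB.
pose a := -1 *: sol x + x; pose b := 1 *: sol x + y.
have Wb : W b by exact: WD.
have ab : x + y = b + a by rewrite /a /b scaleN1r scale1r addrACA subrr add0r addrC.
have b0 z : W z -> B z a = 0 by move=> Wz; rewrite bilin_symDr// solP// mulN1r addNr.
have sx : schur_form x x = B a a.
  rewrite {1}/a (proj1 bB) (b0 _ (sol_in x)) mulr0 add0r /a bilin_symDr//.
  by rewrite /schur_form mulN1r addrC.
rewrite ab bilin_symDD// b0// mulr0 addr0 sx lerDr; exact: B0.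
Qed.

End schur.

Lemma mem_span_map (I : eqType) (r : seq I) (f : I -> V) x : uniq r ->
  x \in <<[seq f i | i <- r]>>%VS -> exists xi : I -> R, x = \sum_(i <- r) xi i *: f i.
Proof.
elim: r x => [|i r IH] x /= => [_|/andP[ir ur]].
  by rewrite span_nil memv0 => /eqP ->; exists (fun=> 0); rewrite big_nil.
rewrite span_cons => /memv_addP[_ /vlineP[k ->] [y /(IH _ ur)[xi ->] ->]].
exists (fun j => if j == i then k else xi j); rewrite big_cons eqxx; congr (_ + _).
apply: eq_big_seq => j jr; case: eqP => // ji.
by move: ir; rewrite -ji jr.
Qed.

(* Expanding [x] in the eigenbasis diagonalizes both forms. *)
Lemma spectral_bound (S Sh : V -> V -> R) (m : nat) (alpha : 'I_m -> R)
    (psi : m.-tuple V) (a : R) x :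
  bilin_sym S -> bilin_sym Sh ->
  (forall i y, y \in <<psi>>%VS -> S y (tnth psi i) = alpha i * Sh y (tnth psi i)) ->
  (forall i j, Sh (tnth psi i) (tnth psi j) = (i == j)%:R) ->
  x \in <<[seq tnth psi i | i <- enum 'I_m & (alpha i < a)%R]>>%VS ->
  S x x <= a * Sh x x.
Proof.
move=> bS bSh eig orth xs.
have xpsi : x \in <<psi>>%VS.
  apply: subvP xs; apply: sub_span => _ /mapP[i _ ->]; exact: mem_tnth.
have [|xi] := mem_span_map _ xs; first by rewrite filter_uniq// enum_uniq.
rewrite big_filter big_enum_cond/= => xE.
have coefE i : alpha i < a -> Sh x (tnth psi i) = xi i.
  move=> ai; rewrite (proj2 bSh) [X in Sh _ X]xE bilin_sym_sumr//.
  rewrite (bigD1 i)//= orth eqxx mulr1 big1 ?addr0// => j /andP[_ ji].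
  by rewrite orth eq_sym (negbTE ji) mulr0.
have -> : S x x = \sum_(i | alpha i < a) alpha i * xi i ^+ 2.
  rewrite {2}xE bilin_sym_sumr//; apply: eq_bigr => i ai.
  by rewrite eig// coefE//; ring.
have -> : Sh x x = \sum_(i | alpha i < a) xi i ^+ 2.
  by rewrite {2}xE bilin_sym_sumr//; apply: eq_bigr => i ai; rewrite coefE// expr2.
rewrite mulr_sumr; apply: ler_sum => i ai.
by rewrite ler_wpM2r ?sqr_ge0// ltW.
Qed.

End semidefinite_forms.

(** * Exponential decay *)

Section decay.
Context {R : realType} {d : nat} (Omega : set 'rV[R]_d)
  (hOmega : polyhedral_domain Omega)
  (A Ah : 'rV[R]_d -> 'M[R]_d) (amin amax : R) (am ap : 'rV[R]_d -> R)
  (hA : elliptic_tensor Omega A Ah amin amax am ap) (M : mesh R d)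
  (H h gamma : R) (Nf : nat) (hM : is_mesh M Omega H h gamma Nf)
  (tr : elt M -> h1fun R d -> 'rV[R]_d -> R) (htr : trace_operator tr)
  (T : elt M -> (h1fun R d -> R) -> h1fun R d) (hT : solution_operator tr A T).
Implicit Types (t s : elt M) (F : face M) (e : subface M).
Local Notation V := {ffun subface M -> R^o}.
Local Notation B := (Tform tr T).

Lemma restr_lin (P : pred (face M)) (k : R) (x y : V) :
  restr P (k *: x + y) = k *: restr P x + restr P y.
Proof. by apply/ffunP => e; rewrite !ffunE; case: ifP => // _; rewrite scaler0 addr0. Qed.

Lemma restr0 (P : pred (face M)) : restr P (0 : V) = 0.
Proof. by apply/ffunP => e; rewrite !ffunE; case: ifP. Qed.

Let LamP := Lambda_hfP hOmega hA hM htr hT.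

Lemma Lambda_hf_lin (k : R) (c c' : elt M -> V) : Lambda_hf Omega tr c ->
  Lambda_hf Omega tr c' -> Lambda_hf Omega tr (fun t => k *: c t + c' t).
Proof.
move=> /LamP[sc oc c0] /LamP[sc' oc' c0']; apply/LamP; split.
- by move=> t e et; rewrite !ffunE sc// sc'// scaler0 addr0.
- move=> e eO; transitivity (k * \sum_(t : elt M) c t e + \sum_(t : elt M) c' t e).
    by rewrite mulr_sumr -big_split; apply: eq_bigr => t _; rewrite !ffunE.
  by rewrite oc// oc'// mulr0 addr0.
- move=> t F Ft; transitivity (k * \sum_(e | par e == F) c t e * fine (leb d.-1 (sdom e))
      + \sum_(e | par e == F) c' t e * fine (leb d.-1 (sdom e))).
    by rewrite mulr_sumr -big_split; apply: eq_bigr => e _; rewrite !ffunE mulrDl mulrA.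
  by rewrite c0// c0'// mulr0 addr0.
Qed.

Lemma Lambda_hf0 : Lambda_hf Omega tr (fun=> 0).
Proof.
apply/LamP; split=> [t e et|e eO|t F Ft]; first by rewrite ffunE.
  by rewrite big1// => t _; rewrite ffunE.
by rewrite big1// => e _; rewrite ffunE mul0r.
Qed.

(** Opposite values are a condition on one subface and zero mean a condition on one face, so both
    survive setting whole faces to zero. *)
Lemma Lambda_hf_restr (P : pred (face M)) (c : elt M -> V) :
  Lambda_hf Omega tr c -> Lambda_hf Omega tr (fun t => restr P (c t)).
Proof.
move=> /LamP[sc oc c0]; apply/LamP; split.
- by move=> t e et; rewrite ffunE sc//; case: ifP.
- move=> e eO; under eq_bigr do rewrite ffunE.
  by case: (P (par e)); [exact: oc|rewrite big1].
- move=> t F Ft; rewrite (eq_bigr (fun e => (if P F then 1 else 0) *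
      (c t e * fine (leb d.-1 (sdom e))))).
    by rewrite -mulr_sumr c0// mulr0.
  by move=> e /eqP eF; rewrite ffunE eF; case: ifP; rewrite ?mul1r ?mul0r.
Qed.

Lemma Tform_psd t : psd (B t).
Proof.
split; last by move=> a; exact: (Tform_ge0 hOmega hA hM htr hT).
split=> [k a b c|a b]; first exact: Tform_linl.
exact: (Tform_sym hOmega hA hM htr hT).
Qed.

Lemma Lambda_Fc_lin t F (k : R) (x y : V) : Lambda_Fc Omega tr t F x ->
  Lambda_Fc Omega tr t F y -> Lambda_Fc Omega tr t F (k *: x + y).
Proof.
move=> [c [hc ->]] [c' [hc' ->]]; exists (fun t => k *: c t + c' t); split.
  exact: Lambda_hf_lin.
by rewrite restr_lin.
Qed.

Lemma Lambda_Fc0 t F : Lambda_Fc Omega tr t F 0.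
Proof. by exists (fun=> 0); split; [exact: Lambda_hf0|rewrite restr0]. Qed.

(** The default value of [xget] is harmless: a projection on the finite-dimensional space
    [Lambda_Fc] exists even for a semidefinite form. *)
Lemma schur_solP t F (x : V) : Lambda_Fc Omega tr t F (schur_sol Omega tr T t F x) /\
  forall y, Lambda_Fc Omega tr t F y ->
    B t y (schur_sol Omega tr T t F x) = B t y x.
Proof.
have [X XP] := subspace_span (Lambda_Fc0 t F) (@Lambda_Fc_lin t F).
have [w wX wx] := psd_projection X x (Tform_psd t).
rewrite /schur_sol; set Q := [set w | _].
suff : Q (xget 0 Q) by [].
by apply: xgetPex; exists w; split; [exact/XP|move=> y /XP; exact: wx].
Qed.

Lemma That_bilin_sym t F : bilin_sym (That Omega tr T t F).
Proof.
apply: (schur_bilin_sym (Tform_psd t) (W := Lambda_Fc Omega tr t F)).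
  by move=> x; have [] := schur_solP t F x.
by move=> x; have [_] := schur_solP t F x.
Qed.

Lemma That_le t F (x y : V) : Lambda_Fc Omega tr t F y ->
  That Omega tr T t F x x <= B t (x + y) (x + y).
Proof.
apply: (schur_form_le (Tform_psd t) (W := Lambda_Fc Omega tr t F)).
- exact: Lambda_Fc_lin.
- by move=> z; have [] := schur_solP t F z.
- by move=> z; have [_] := schur_solP t F z.
Qed.

Lemma bilin_sym_sum (I : Type) (r : seq I) (P : pred I) (f : I -> V -> V -> R) :
  (forall i, bilin_sym (f i)) ->
  bilin_sym (fun x y => \sum_(i <- r | P i) f i x y).
Proof.
move=> bf; split=> [k u v w|u v].
  by rewrite mulr_sumr -big_split; apply: eq_bigr => i _; rewrite (proj1 (bf i)).
by apply: eq_bigr => i _; exact: (proj2 (bf i)).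
Qed.

Lemma restr_opposite (c : elt M -> V) t s F : Lambda_hf Omega tr c ->
  F \in faces t -> F \in faces s -> s != t ->
  restr (pred1 F) (c s) = - restr (pred1 F) (c t).
Proof.
move=> /LamP[sc oc _] Ft Fs st; have [FE FO] := interior_face hM st Fs Ft.
apply/ffunP => e; rewrite !ffunE /=; case: eqP => [eF|]; last by rewrite oppr0.
apply/eqP; rewrite -addr_eq0; apply/eqP; rewrite -[RHS](oc e); last by rewrite eF.
rewrite (bigD1 s)//= (bigD1 t)/=; last by rewrite eq_sym.
rewrite big1 ?addr0// => r /andP[rs rt]; apply: sc; rewrite eF -mem_elts FE in_set2.
by rewrite (negbTE rs) (negbTE rt).
Qed.

(** On [s] the data [c s] extend the face part of [c t], up to the sign seen from the other side, so
    they compete in the minimum that defines the Schur complement. A quadratic form ignores the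
    sign. *)
Lemma That_energy_le (c : elt M -> V) t s F : Lambda_hf Omega tr c ->
  F \in faces t -> F \in faces s ->
  That Omega tr T s F (restr (pred1 F) (c t)) (restr (pred1 F) (c t)) <=
    B s (c s) (c s).
Proof.
move=> hc Ft Fs; have [sc _ _] := (LamP c).1 hc.
pose y := restr (fun F' => (F' \in faces s) && (F' != F)) (c s).
have hy : Lambda_Fc Omega tr s F y by exists c.
have csE : c s = restr (pred1 F) (c s) + y.
  apply/ffunP => e; rewrite !ffunE /=.
  have [->|eF] := eqVneq (par e) F; first by rewrite Fs/= addr0.
  by case: ifPn => [|]; rewrite ?add0r// andbT => /sc.
have [<-|st] := eqVneq s t; first by rewrite [X in _ <= B s X X]csE; exact: That_le.
have [bB _] := Tform_psd s.
rewrite -[X in _ <= X](bilin_symNN _ bB).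
have -> : - c s = restr (pred1 F) (c t) + (-1 *: y + 0).
  by rewrite {1}csE opprD (restr_opposite hc Ft Fs st) opprK addr0 scaleN1r.
by apply: That_le; apply: Lambda_Fc_lin => //; exact: Lambda_Fc0.
Qed.

(** * Energy decay for data in the stable space *)

Section stable_part.
Variables (m : face M -> nat) (alpha : forall F : face M, 'I_(m F) -> R)
  (psi : forall F : face M, (m F).-tuple V)
  (hpsi : forall F : face M, eigenbasis Omega tr T F (@alpha F) (psi F))
  (astab : R) (hastab : 1 <= astab).
Variables (mu : elt M -> V) (hmu : Lambda_tri Omega tr astab alpha psi mu).

Local Notation En t := (B t (mu t) (mu t)).

Lemma En_ge0 t : 0 <= En t.
Proof. by have [_] := Tform_psd t. Qed.

(** The eigenproblem of an interior face compares sums over both elements, not the elements one by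
    one; this brings the energy of both sides into the bound. *)
Lemma face_energy_le t F : F \in faces t ->
  \sum_(s in elts F) B s (restr (pred1 F) (mu t)) (restr (pred1 F) (mu t)) <=
  astab * \sum_(s in elts F) En s.
Proof.
move=> Ft; have [hc /(_ F t Ft) xtri] := hmu.
have [_ LF _ eig orth] := hpsi F.
set x := restr _ _ in xtri *.
apply: (@le_trans _ _ (astab * \sum_(s in elts F) That Omega tr T s F x x)).
  pose S (y z : V) : R := \sum_(s in elts F) B s y z.
  pose Sh (y z : V) : R := \sum_(s in elts F) That Omega tr T s F y z.
  have bS : bilin_sym S by apply: bilin_sym_sum => s; have [] := Tform_psd s.
  have bSh : bilin_sym Sh by apply: bilin_sym_sum => s; exact: That_bilin_sym.
  have eigS i y : y \in <<psi F>>%VS ->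
      S y (tnth (psi F) i) = alpha i * Sh y (tnth (psi F) i).
    by move=> /LF; exact: eig.
  exact: (spectral_bound bS bSh eigS orth xtri).
rewrite ler_wpM2l ?(le_trans ler01)//; apply: ler_sum => s.
by rewrite mem_elts => Fs; exact: That_energy_le.
Qed.

(* Since [astab >= 1], the weight of [En t] in Young's inequality can be
   absorbed: a single factor [astab] remains. *)
Lemma face_coupling_le t F : F \in faces t ->
  B t (restr (pred1 F) (mu t)) (mu t) <= astab * \sum_(s in elts F) En s.
Proof.
move=> Ft; have := psd_young (restr (pred1 F) (mu t)) (mu t) (Tform_psd t).
have := face_energy_le Ft.
have tF : t \in elts F by rewrite mem_elts.
set x := restr _ _; set G := \sum_(s in elts F) En s.
have xG : B t x x <= \sum_(s in elts F) B s x x.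
  rewrite [X in _ <= X](bigD1 t)//= lerDl; apply: sumr_ge0 => s _.
  by have [_] := Tform_psd s.
have tG : En t <= G.
  by rewrite /G (bigD1 t)//= lerDl; apply: sumr_ge0 => s _; exact: En_ge0.
have G0 : G <= astab * G by rewrite ler_peMl// (le_trans (En_ge0 t)).
lra.
Qed.

Variables (K : elt M) (v : elt M -> h1fun R d) (hv : H1mesh v)
  (hsupp : supported_in K v).
Hypothesis mu_orth : forall nu, Lambda_tri Omega tr astab alpha psi nu ->
  \sum_(t : elt M) B t (nu t) (mu t) = \sum_(t : elt M) fcst tr t (nu t) (v t).

Definition touched j : pred (face M) :=
  fun F => [exists t, (t \in patches K j) && (F \in faces t)].

Lemma touched_patch j t F : (0 < j)%N -> F \in faces t -> touched j F ->
  t \in patches K j.+1.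
Proof.
move=> j0 Ft /existsP[t' /andP[t'K Ft']].
exact: (patch_neighbour hM j0 t'K Ft Ft').
Qed.

Lemma truncated_orth j : (0 < j)%N ->
  \sum_(t : elt M) B t (restr (predC (touched j)) (mu t)) (mu t) = 0.
Proof.
move=> j0; have [hc tri] := hmu; have [sc _ _] := (LamP mu).1 hc.
rewrite (mu_orth (nu := fun t => restr (predC (touched j)) (mu t))); last first.
  split; first exact: Lambda_hf_restr.
  move=> F t Ft.
  have -> : restr (pred1 F) (restr (predC (touched j)) (mu t)) =
      if touched j F then 0 else restr (pred1 F) (mu t).
    apply/ffunP => e; case tF: (touched j F); rewrite !ffunE /=;
      by case: eqP => // eF; rewrite eF tF.
  by case: ifP => _; [exact: mem0v|exact: tri].
(* Off [K] the function [v] vanishes; on [K] the truncated data do, because [j > 0] puts [K] in the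
   patch and so makes all its faces touched. *)
apply: big1 => t _; have [->|tK] := eqVneq t K; last first.
  exact: (fcst_zero hM htr _ (hv t) (hsupp tK)).
have -> : restr (predC (touched j)) (mu K) = 0; last exact: fcst0.
apply/ffunP => e; rewrite !ffunE /=; case: ifPn => // /existsPn/(_ K).
by rewrite (center_in_patches hM K j0)/= => /sc.
Qed.

(** The quantity [E_j] of the overview; [outer 0] is the total energy, as [patches K 0] is empty. *)
Definition outer j := \sum_(t in ~: patches K j) En t.

Lemma touched_part j t :
  mu t - restr (predC (touched j)) (mu t) =
    \sum_(F in faces t | touched j F) restr (pred1 F) (mu t).
Proof.
have [hc _] := hmu; have [sc _ _] := (LamP mu).1 hc.
apply/ffunP => e; rewrite sum_ffunE !ffunE /=.
have [et|et] := boolP (par e \in faces t); last first.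
  rewrite sc// if_same subr0 big1// => F _; rewrite !ffunE sc// if_same//.
case: ifPn => [te|/negPn te].
  rewrite subrr big1// => F /andP[_ tF]; rewrite !ffunE/=; case: eqP => // eF.
  by move: te; rewrite eF tF.
rewrite subr0 (bigD1 (par e)) ?et//= !ffunE/= eqxx big1 ?addr0// => F /andP[_ eF].
by rewrite !ffunE/= eq_sym (negbTE eF).
Qed.

(** The orthogonality splits over three regions: inside the patch the truncated data [nu] vanish,
    beyond the next patch they equal [mu], and on the ring in between they are [mu] minus its parts
    on touched faces. The energy of the ring is nonnegative and is discarded. *)
Lemma outer_le_coupling j : (0 < j)%N ->
  outer j.+1 <= \sum_(t in patches K j.+1 :\: patches K j)
    \sum_(F in faces t | touched j F) B t (restr (pred1 F) (mu t)) (mu t).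
Proof.
move=> j0; have [hc _] := hmu; have [sc _ _] := (LamP mu).1 hc.
pose nu t := restr (predC (touched j)) (mu t).
have subK := patches_sub hM K j.
have : \sum_(t : elt M) B t (nu t) (mu t) = 0 by exact: truncated_orth.
rewrite (bigID (mem (patches K j.+1)))/= (bigID (mem (patches K j)))/=.
rewrite big1 ?add0r; last first.
  move=> t /andP[_ tK]; have [bB _] := Tform_psd t.
  suff -> : nu t = 0 by rewrite bilin_sym0.
  apply/ffunP => e; rewrite !ffunE /=; case: ifPn => // /existsPn/(_ t).
  by rewrite tK/= => /sc.
have -> : \sum_(t | t \notin patches K j.+1) B t (nu t) (mu t) = outer j.+1.
  apply: eq_big => [t|t tK]; first by rewrite finset.inE.
  suff -> : nu t = mu t by [].
  apply/ffunP => e; rewrite !ffunE /=; case: ifPn => // /negPn te.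
  rewrite sc//; apply: contra tK => et; exact: touched_patch te.
have -> : \sum_(t | (t \in patches K j.+1) && (t \notin patches K j)) B t (nu t) (mu t) =
  \sum_(t in patches K j.+1 :\: patches K j) (En t -
    \sum_(F in faces t | touched j F) B t (restr (pred1 F) (mu t)) (mu t)).
  apply: eq_big => [t|t /andP[tK _]]; first by rewrite finset.inE andbC.
  rewrite -(fcst_sum tr) -touched_part.
  have := Tform_linl tr T t (-1) (mu t - nu t) (mu t) (mu t).
  by rewrite scaleN1r opprB subrK mulN1r addrC.
rewrite sumrB => E0.
have L0 : 0 <= \sum_(t in patches K j.+1 :\: patches K j) En t.
  by apply: sumr_ge0 => t _; exact: En_ge0.
lra.
Qed.

(* A touched face has two elements, one of which lies in the inner patch. *)
Lemma interface_count j F s : (0 < j)%N ->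
  (\sum_(t : elt M) [&& t \in patches K j.+1 :\: patches K j, F \in faces t,
      touched j F & F \in faces s]
    <= (F \in faces s) && (s \in patches K j.+1 :\: patches K j.-1))%N.
Proof.
move=> j0; have [|] := boolP ((F \in faces s) && touched j F); last first.
  rewrite negb_and => nF; rewrite big1// => t _.
  by case: (touched j F) nF; case: (F \in faces s); rewrite ?orbF ?andbF.
move=> /andP[Fs tF]; have /existsP[t' /andP[t'K Ft']] := tF.
have [/existsP[t /andP[tL Ft]]|/existsPn none] := boolP [exists t,
    (t \in patches K j.+1 :\: patches K j) && (F \in faces t)]; last first.
  rewrite big1// => t _; have := none t.
  by rewrite negb_and => /orP[/negbTE -> //|/negbTE ->]; rewrite andbF.
have tt' : t != t'.
  by apply: contraTneq tL => ->; rewrite finset.inE t'K.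
have [FE _] := interior_face hM tt' Ft Ft'.
rewrite (bigD1 t)//= big1 => [|r rt].
  rewrite addn0 tL Ft tF Fs/= lt0b finset.inE (touched_patch j0 Fs tF) andbT.
  apply/negP => sK.
  (* For [j = 1] the patch [patches K 0] is empty and [sK] is absurd. *)
  have j1 : (0 < j.-1)%N by case: (j.-1) sK => //; rewrite finset.in_set0.
  have := patch_neighbour hM j1 sK Ft Fs; rewrite prednK//.
  by move: tL; rewrite finset.inE => /andP[/negbTE ->].
apply/eqP; rewrite eqb0; apply/negP => /and4P[rL Fr _ _].
have : r \in elts F by rewrite mem_elts.
rewrite FE in_set2 (negbTE rt)/= => /eqP rt'.
by move: rL; rewrite rt' finset.inE t'K.
Qed.

(** Summed over the touched faces of the ring, the energy of an element [s] occurs at most once per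
    face of [s], and only if [s] lies between the patches [j.-1] and [j.+1]: an inner element across
    such a face cannot be in patch [j.-1], or its neighbour in the ring would be in patch [j]. *)
Lemma outer_step j : (0 < j)%N ->
  outer j.+1 <= Nf%:R * astab * (outer j.-1 - outer j.+1).
Proof.
move=> j0; apply: le_trans (outer_le_coupling j0) _.
have -> : outer j.-1 - outer j.+1 = \sum_(s in patches K j.+1 :\: patches K j.-1) En s.
  rewrite /outer (big_setID (~: patches K j.+1))/=.
  have s1 := patches_sub hM K j.-1; have s2 := patches_sub hM K j.
  rewrite prednK// in s1; have s3 := fintype.subset_trans s1 s2.
  rewrite (finset.setIidPr _); last by rewrite finset.setCS.
  rewrite addrC addrK; apply: eq_bigl => s; rewrite !finset.inE negbK andbC.
  by [].
apply: (@le_trans _ _ (\sum_(t in patches K j.+1 :\: patches K j)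
    \sum_(F in faces t | touched j F) astab * \sum_(s in elts F) En s)).
  by apply: ler_sum => t _; apply: ler_sum => F /andP[Ft _]; exact: face_coupling_le.
(* Encoding all constraints in one indicator frees the three summation ranges, so that the sums can
   be exchanged and the pairs [(F, t)] counted for a fixed [s]. *)
pose b t F s := [&& t \in patches K j.+1 :\: patches K j, F \in faces t,
      touched j F & F \in faces s].
have -> : \sum_(t in patches K j.+1 :\: patches K j)
    \sum_(F in faces t | touched j F) astab * \sum_(s in elts F) En s =
    astab * \sum_(s : elt M) (\sum_(F : face M) \sum_(t : elt M) b t F s)%:R * En s.
  transitivity (\sum_(t : elt M) \sum_(F : face M) \sum_(s : elt M)
      astab * ((b t F s)%:R * En s)).
    rewrite big_mkcond; apply: eq_bigr => t _; rewrite /b.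
    case: ifP => tL; last by rewrite [RHS]big1// => F _; rewrite [LHS]big1// => s _; rewrite mul0r mulr0.
    rewrite big_mkcond; apply: eq_bigr => F _ /=.
    case: (F \in faces t); last by rewrite [RHS]big1// => s _; rewrite mul0r mulr0.
    case: (touched j F); last by rewrite [RHS]big1// => s _; rewrite mul0r mulr0.
    rewrite /= mulr_sumr big_mkcond; apply: eq_bigr => s _; rewrite mem_elts.
    by case: ifP; rewrite ?mul1r ?mul0r ?mulr0.
  rewrite mulr_sumr exchange_big/=; under eq_bigr do rewrite exchange_big/=.
  rewrite exchange_big; apply: eq_bigr => s _ /=.
  rewrite natr_sum mulr_suml mulr_sumr; apply: eq_bigr => F _.
  by rewrite natr_sum mulr_suml mulr_sumr.
rewrite [_ * astab]mulrC -mulrA ler_wpM2l ?(le_trans ler01)//.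
rewrite mulr_sumr [X in _ <= X]big_mkcond; apply: ler_sum => s _.
have [_ _ _ /(_ s) NfP _] := hM.
apply: (@le_trans _ _ ((\sum_(F : face M)
    ((F \in faces s) && (s \in patches K j.+1 :\: patches K j.-1)))%:R * En s)).
  by rewrite ler_wpM2r ?En_ge0// ler_nat; apply: leq_sum => F _; exact: interface_count.
case: ifP => _; last by rewrite big1 ?mul0r// => F _; rewrite andbF.
rewrite ler_wpM2r ?En_ge0// ler_nat (leq_trans _ NfP)//.
by rewrite -sum1_card [X in (_ <= X)%N]big_mkcond; apply: leq_sum => F _; rewrite andbT; case: ifP.
Qed.

Lemma outer_decay k :
  outer k <= expR (- (k./2%:R / (1 + Nf%:R * astab))) * outer 0.
Proof.
pose N : R := Nf%:R * astab.
have N0 : 0 <= N by rewrite mulr_ge0// (le_trans ler01).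
have o0 j : 0 <= outer j by apply: sumr_ge0 => t _; exact: En_ge0.
(* [outer_step] skips an index, so the induction carries two consecutive ones; the halves of 0 and 1
   are both 0 in the base case. *)
suff Hk : outer k <= expR (- (k./2%:R / (1 + N))) * outer 0 /\
    outer k.+1 <= expR (- (k.+1./2%:R / (1 + N))) * outer 0 by have [] := Hk.
elim: k => [|k [IH1 IH2]].
  rewrite /= mul0r oppr0 expR0 !mul1r; split=> //.
  rewrite /outer [X in _ <= X](big_setID (~: patches K 1))/=.
  rewrite (finset.setIidPr _); last by rewrite finset.setCS finset.sub0set.
  by rewrite lerDl; apply: sumr_ge0 => t _; exact: En_ge0.
split=> //.
have := @outer_step k.+1 isT; rewrite -/N /= => step.
have c0 : 0 < 1 + N by rewrite ltr_pwDl.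
apply: (@le_trans _ _ (expR (- (1 + N)^-1) * outer k)).
  (* The step rearranges to [(1 + N) E_{k+2} <= N E_k], and [N / (1 + N)] is [1 - 1 / (1 + N)],
     which is at most the exponential of [- 1 / (1 + N)]. *)
  apply: (@le_trans _ _ ((1 - (1 + N)^-1) * outer k)).
    rewrite -(ler_pM2l c0) mulrA mulrBr mulr1 divff ?gt_eqF//.
    lra.
  by rewrite ler_wpM2r// expR_ge1Dx.
rewrite (_ : k.+2./2%:R / (1 + N) = (1 + N)^-1 + k./2%:R / (1 + N)).
  by rewrite opprD expRD -mulrA ler_wpM2l// expR_ge0.
by rewrite /= -add1n natrD mulrDl mul1r.
Qed.

End stable_part.
End decay.


Theorem theorem3 (R : realType) (d : nat) (hd : d = 2%N \/ d = 3%N)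
  (Omega : set 'rV[R]_d) (hOmega : polyhedral_domain Omega)
  (A Ah : 'rV[R]_d -> 'M[R]_d) (amin amax : R) (am ap : 'rV[R]_d -> R)
  (hA : elliptic_tensor Omega A Ah amin amax am ap)
  (M : mesh R d) (H h gamma : R) (Nf : nat)
  (hM : is_mesh M Omega H h gamma Nf)
  (tr : elt M -> h1fun R d -> 'rV[R]_d -> R) (htr : trace_operator tr)
  (T : elt M -> (h1fun R d -> R) -> h1fun R d)
  (hT : solution_operator tr A T)
  (m : face M -> nat) (alpha : forall F : face M, 'I_(m F) -> R)
  (psi : forall F : face M, (m F).-tuple {ffun subface M -> R^o})
  (hpsi : forall F : face M, eigenbasis Omega tr T F (@alpha F) (psi F))
  (astab : R) (hastab : 1 <= astab)
  (K : elt M) (v : elt M -> h1fun R d) (hv : H1mesh v)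
  (hsupp : supported_in K v)
  (mu : elt M -> {ffun subface M -> R^o})
  (hmu : is_Ptri Omega tr T astab alpha psi v mu)
  (j : nat) (hj : (1 <= j)%N) :
  let Tmu := fun t : elt M => T t (fcst tr t (mu t)) in
  energy Ah (~: patches K j.+1)%SET Tmu <=
  expR (- ((j.+1)./2%:R / (1 + Nf%:R * astab))) * energy Ah [set: elt M]%SET Tmu.
Proof.
have [htri horth] := hmu; cbv zeta.
rewrite !(energyE hOmega hA hM htr hT).
have := outer_decay hOmega hA hM htr hT hpsi hastab htri hv hsupp horth j.+1.
by rewrite /outer /= finset.setC0.
Qed.
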